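(* Let $Z$ be an $n$-dimensional standard Gaussian vector. Let $f$ be a (real-valued) convex function on $\mathbb R^n$ with $f\in L_1(\gamma_n)$ and let $M$ be a median for $f(Z)$. Then, for all $t>0$, $$\mathbb P \left( f(Z) -M < -t\, \mathbb E (f(Z)-M)_+ \right) \leq \Phi \left(- \frac{\sqrt{2\pi}}{32}\, t \right).$$
   Context: $\gamma_n$ denotes the standard Gaussian measure on $\mathbb R^n$, i.e. the law of $Z\sim N(\mathbf 0,I_n)$. $\Phi(x)=\frac{1}{\sqrt{2\pi}}\int_{-\infty}^x e^{-z^2/2}\,dz$ is the cumulative distribution function of a standard Gaussian random variable. For a real number $u$, $u_+=\max\{u,0\}$. A median of a real random variable $Y$ is a number $M$ with $\mathbb P(Y\le M)\ge 1/2$ and $\mathbb P(Y\ge M)\ge 1/2$. *)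

(* Defs.v *)
From HB Require Import structures.
From mathcomp Require Import all_boot all_order all_algebra.
From mathcomp Require Import all_classical all_reals all_analysis.

Set Implicit Arguments.
Unset Strict Implicit.
Unset Printing Implicit Defensive.
Import Order.TTheory GRing.Theory Num.Theory.
Import numFieldNormedType.Exports.

Local Open Scope classical_set_scope.
Local Open Scope ring_scope.

(* R^n is ['rV[R]_n], with the Borel sigma-algebra of its library topology. *)
HB.instance Definition _ (R : realType) (n : nat) :=
  Measurable.copy 'rV[R]_n (g_sigma_algebraType (@open 'rV[R]_n)).

(* Z ~ N(0, I_n): the coordinates of Z are mutually independent standard
   normal variables.  Allowing [A i = setT] in the product rule covers the
   subfamilies of the coordinates. *)
Definition std_gaussian_vector d (Omega : measurableType d) (R : realType)
    (P : probability Omega R) (n : nat) (Z : {RV P >-> 'rV[R]_n}) : Prop :=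
  (forall (i : 'I_n) (A : set R), measurable A ->
     P [set w | A (Z w ord0 i)] = normal_prob 0 1 A) /\
  (forall A : 'I_n -> set R, (forall i, measurable (A i)) ->
     P [set w | forall i, A i (Z w ord0 i)] =
     (\prod_(i < n) P [set w | A i (Z w ord0 i)])%E).

Definition median d (Omega : measurableType d) (R : realType)
    (P : probability Omega R) (Y : Omega -> R) (M : R) : Prop :=
  (P [set w | (Y w <= M)%R] >= (2^-1)%:E)%E /\
  (P [set w | (Y w >= M)%R] >= (2^-1)%:E)%E.

Definition Phi (R : realType) (x : R) : R :=
  (Num.sqrt (2 * pi))^-1 *
  \int[lebesgue_measure]_(z in `]-oo, x]) expR (- z ^+ 2 / 2).

(* Main.v *)
From HB Require Import structures.
Require Import Defs.
From mathcomp Require Import all_boot all_order all_algebra.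
From mathcomp Require Import all_classical all_reals all_analysis.
From mathcomp Require Import measurable_realfun.
From mathcomp Require Import ring lra.

Set Implicit Arguments.
Unset Strict Implicit.
Unset Printing Implicit Defensive.
Import Order.TTheory GRing.Theory Num.Theory.
Import numFieldNormedType.Exports.
Import HBNNSimple.

Local Open Scope classical_set_scope.
Local Open Scope ring_scope.

(** Let [g] be the standard Gaussian law on R^n, [E] the mean of [(f(Z) - M)_+]
    and [sg = sqrt (2 pi)].  The bound is proved in inverse form
    (excess_ge_quantile_gap): for [s], [r > 0], if the sublevel set [f <= M - s] has
    probability at least [Phi (- r)], then [sg * s <= 32 * r * E].  For [r = sg / 32 * t]
    this says [s <= t * E].  So [P (f(Z) <= M - s) <= Phi (- r)] for every
    [s > t * E], and the event [f(Z) - M < - t * E] is the increasing union of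
    such sublevel events.

    The inverse form follows from two inequalities for the free energy
    [A(f) = - ln (int exp (- f) dg)] of nonnegative functions:

    - Prekopa-Leindler (prekopa_leindler): if
      [h ((1 - l) x + l y) <= (1 - l) f x + l k y] with [f], [k] convex, then
      [A(h) <= (1 - l) A(f) + l A(k)];
    - a gain (gaussian_gain): if [h ((1 - e) x + e y) <= f x + e^2 k y] with
      [k] convex and [f] bounded, then [A(h) <= int f dg + e^2 A(k)].

    In the second one the point moves towards [y] by a fraction [e], yet
    [A(k)] only enters with weight [e^2].  On the line, let [T] be the monotone
    map that carries [g] to the density proportional to [exp (- k) g].  Since
    [k] is convex, [T] is a contraction (convex1_contraction), so its
    displacement [x - T x] has derivative in [0, 1].  Displacing the Gaussian by
    [e (x - T x)] contributes a first-order term that is an exact divergence;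
    it vanishes after Jensen's inequality and integration by parts
    (gauss_jensen), and what is left is of order [e^2].  Prekopa-Leindler on the
    line is the analogous computation with the monotone map between the
    densities proportional to [exp (- f) g] and [exp (- k) g].  Both extend to
    R^n by induction: integrating out all coordinates but the first turns
    [f] into the one-variable function [x |-> A(f(x, .))], which is again convex
    by Prekopa-Leindler, and [A(f)] is the free energy of that function.

    To conclude, bound [Phi (- r)] below by [exp (- D) / 2] with
    [D = 2 r / sg + r^2 / 2] (dcdf_gdens_lower).  Applied to large multiples of
    [(f - a)_+], Prekopa-Leindler makes the probabilities of the sublevel sets
    log-concave in the level.  As [f] is below [M - s] with probability at least
    [exp (- D) / 2] and below any level smaller than [M] with probability at
    most [1 / 2], it cannot be below [M + u] too often, and Markov's inequality
    bounds [E] below by a multiple of [s / D].  This is enough when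
    [sg * r <= 47 / 20].  For larger [r] one has to reach [s / r] instead of
    [s / r^2], and this is what the gain achieves, with [e = 1 / (4 r)], for
    [f], [h], [k] multiples of [(f - M)_+], [(f - M + e s)_+], [(f - M + s)_+],
    the first two truncated. *)

(** * Integrals against pushforwards; change of variables on the line *)

Lemma ge0_integral_transfer d1 d2 (X : measurableType d1)
    (Y : measurableType d2) (R : realType) (mu : {measure set X -> \bar R})
    (nu : {measure set Y -> \bar R}) (S : X -> Y) (w : X -> R)
    (mS : measurable_fun setT S) (mw : measurable_fun setT w)
    (w0 : forall x, 0 <= w x)
    (nuE : forall A, measurable A ->
      nu A = (\int[mu]_(x in S @^-1` A) (w x)%:E)%E)
    (f : Y -> \bar R) (mf : measurable_fun setT f) (f0 : forall y, (0 <= f y)%E) :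
  (\int[nu]_y f y = \int[mu]_x (f (S x) * (w x)%:E))%E.
Proof.
have mSA A : measurable A -> measurable (S @^-1` A).
  by move=> mA; rewrite -[X in measurable X]setTI; exact: mS.
have intE A : measurable A ->
    (\int[nu]_y (\1_A y)%:E = \int[mu]_x ((\1_A (S x))%:E * (w x)%:E))%E.
  move=> mA; rewrite integral_indic//= setIT nuE// integral_mkcond.
  apply: eq_integral => x _; rewrite patchE indicE/=.
  have [xA|xA] := boolP (x \in S @^-1` A).
    by rewrite mem_set ?mul1e//; move: xA; rewrite inE.
  rewrite memNset ?mul0e//; move: xA; rewrite notin_setE; exact.
pose f_ := nnsfun_approx measurableT mf.
have fE (n : nat) : (\int[nu]_y (f_ n y)%:E =
    \int[mu]_x ((f_ n (S x))%:E * (w x)%:E))%E.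
  set g := f_ n.
  under [LHS]eq_integral do rewrite fimfunE -fsumEFin//.
  rewrite [LHS]ge0_integral_fsum//; last 2 first.
    - by move=> r; exact/measurable_EFinP/measurableT_comp.
    - by move=> k x _; rewrite EFinM nnfun_muleindic_ge0.
  under [RHS]eq_integral.
    move=> x xD; rewrite fimfunE -fsumEFin// muleC ge0_mule_fsumr; last first.
      by move=> r; rewrite EFinM nnfun_muleindic_ge0.
    over.
  have mI r : measurable_fun setT (fun x => \1_(g @^-1` [set r]) (S x) : R).
    by apply: (measurableT_comp _ mS).
  rewrite [RHS]ge0_integral_fsum//; last 2 first.
    - move=> r; apply/measurable_EFinP/measurable_funM => //.
      exact: measurable_funM.
    - move=> k x _; rewrite mule_ge0 ?lee_fin//.
      by have := nnfun_muleindic_ge0 g k (S x); rewrite -EFinM lee_fin.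
  apply: eq_fsbigr => r _.
  have [r0|r0] := leP 0 r; last first.
    have g0 : g @^-1` [set r] = set0.
      rewrite -subset0 => y /= gy; have : 0 <= g y by [].
      by rewrite [g y]gy leNgt r0.
    by rewrite g0; rewrite !integral0_eq//= => x _; rewrite indicE in_set0
      mulr0 ?mule0.
  under eq_integral do rewrite EFinM.
  rewrite ge0_integralZl//; last first.
    by apply/measurable_EFinP/measurable_indic.
  rewrite intE// -ge0_integralZl//; last 2 first.
    - by apply/measurable_EFinP/measurable_funM.
    - by move=> x _; rewrite mule_ge0// lee_fin.
  by apply: eq_integral => x _; rewrite -!EFinM; congr EFin; ring.
transitivity (limn (fun n => \int[nu]_y (f_ n y)%:E)%E).
  rewrite -monotone_convergence//=.
  - apply: eq_integral => y _; apply/esym/cvg_lim => //=.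
    by apply: cvg_nnsfun_approx => // *; exact: f0.
  - by move=> n; exact/measurable_EFinP/measurable_funTS.
  - by move=> n y _; rewrite lee_fin.
  - by move=> y _ m n mn; rewrite lee_fin; exact/lefP/nd_nnsfun_approx.
under eq_fun do rewrite fE.
rewrite -monotone_convergence//=.
- apply: eq_integral => x _; apply/cvg_lim => //=.
  apply: cvgeZr => //; apply: cvg_nnsfun_approx => // *; exact: f0.
- move=> n; apply/measurable_EFinP/measurable_funM => //.
  exact: measurableT_comp.
- by move=> n x _; rewrite mule_ge0// lee_fin.
- move=> x _ m n mn; apply: lee_wpmul2r; rewrite ?lee_fin//.
  exact/lefP/nd_nnsfun_approx.
Qed.

(** Packages the pushforward by [S] of the measure with density [w], so that
    uniqueness theorems for measures apply to it. *)
Lemma pushforward_density_measure d1 d2 (X : measurableType d1)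
    (Y : measurableType d2) (R : realType) (mu : {measure set X -> \bar R})
    (S : X -> Y) (w : X -> R) (mS : measurable_fun setT S)
    (mw : measurable_fun setT w) (w0 : forall x, 0 <= w x) :
  exists nu : {measure set Y -> \bar R}, forall A, measurable A ->
    nu A = (\int[mu]_(x in S @^-1` A) (w x)%:E)%E.
Proof.
pose nu0 (A : set Y) := (\int[mu]_(x in S @^-1` A) (w x)%:E)%E.
have nu00 : nu0 set0 = 0%E by rewrite /nu0 preimage_set0 integral_set0.
have nu0ge A : (0 <= nu0 A)%E.
  by apply: integral_ge0 => x _; rewrite lee_fin.
have mSA A : measurable A -> measurable (S @^-1` A).
  by move=> mA; rewrite -[X in measurable X]setTI; exact: mS.
have nu0add : semi_sigma_additive nu0.
  move=> F mF tF mUF; rewrite /nu0; apply: cvg_toP.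
    apply: ereal_nondecreasing_is_cvgn => m n mn.
    by apply: lee_sum_nneg_natr => // k _ _; exact: nu0ge.
  rewrite preimage_bigcup ge0_integral_bigcup//=.
  - by move=> k; exact: mSA.
  - by apply: measurable_funTS; apply/measurable_EFinP.
  - by move=> x _; rewrite lee_fin.
  - apply/trivIsetP => i j _ _ ij; rewrite -preimage_setI.
    by move/trivIsetP : tF => ->//; rewrite preimage_set0.
pose nu : {measure set Y -> \bar R} :=
  HB.pack nu0 (isMeasure.Build _ _ _ nu0 nu00 nu0ge nu0add).
by exists nu.
Qed.

Lemma is_derive1_continuous (R : realType) (S : R -> R) (x l : R) :
  is_derive x 1 S l -> {for x, continuous S}.
Proof. by case=> dS _; exact/differentiable_continuous/derivable1_diffP. Qed.

Lemma derive_lower_bound (R : realType) (S S' : R -> R) (c : R) :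
  (forall x : R, is_derive x 1 S (S' x)) -> (forall x, c <= S' x) ->
  forall x y : R, x <= y -> c * (y - x) <= S y - S x.
Proof.
move=> dS cS x y; rewrite le_eqVlt => /predU1P[->|xy].
  by rewrite !subrr mulr0.
have cont : {within `[x, y], continuous S}.
  apply: continuous_subspaceT => z.
  exact: is_derive1_continuous (dS z).
have [z _ ->] := MVT xy (fun z _ => dS z) cont.
by apply: ler_wpM2r => //; rewrite subr_ge0 ltW.
Qed.

Lemma surjective_derive (R : realType) (S S' : R -> R) (c : R) :
  0 < c -> (forall x : R, is_derive x 1 S (S' x)) -> (forall x, c <= S' x) ->
  forall y, exists x, S x = y.
Proof.
move=> c0 dS cS y.
have cont a b : {within `[a, b], continuous S}.
  apply: continuous_subspaceT => z.
  exact: is_derive1_continuous (dS z).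
have slope := derive_lower_bound dS cS.
pose r := `|y - S 0| / c.
have r0 : 0 <= r by rewrite divr_ge0 ?normr_ge0 ?ltW.
have rc : c * r = `|y - S 0| by rewrite /r mulrCA divff ?mulr1// gt_eqF.
have hr : y <= S r.
  have := slope 0 r r0; rewrite subr0 rc => h.
  have := ler_norm (y - S 0); lra.
have hl : S (- r) <= y.
  have := slope (- r) 0; rewrite oppr_le0 => /(_ r0).
  rewrite sub0r opprK rc => h.
  have := ler_norm (- (y - S 0)); rewrite normrN; lra.
have rr : - r <= r by lra.
have [|x _ Sx] := IVT rr (cont _ _) (v := y); last by exists x.
by rewrite ge_min hl le_max hr orbT.
Qed.

(** The pushforward by [S] of the measure with density [S'] gives mass [b - a]
    to the interval from [a] to [b], by the fundamental theorem of calculus, and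
    Lebesgue measure is the only such measure.  Only measurability is asked of
    [f], since the integrand comes from a function [h] that need not be
    continuous. *)
Lemma change_of_variables (R : realType) (S S' : R -> R) (c : R) (c0 : 0 < c)
    (dS : forall x : R, is_derive x 1 S (S' x)) (cS' : continuous S')
    (cS : forall x, c <= S' x) (f : R -> \bar R) (mf : measurable_fun setT f)
    (f0 : forall y, (0 <= f y)%E) :
  (\int[lebesgue_measure]_y f y =
   \int[lebesgue_measure]_x (f (S x) * (S' x)%:E))%E.
Proof.
have contS : continuous S.
  by move=> z; exact: is_derive1_continuous (dS z).
have mS : measurable_fun setT S by exact: continuous_measurable_fun.
have mS' : measurable_fun setT S' by exact: continuous_measurable_fun.
have S'0 x : 0 <= S' x by rewrite (le_trans _ (cS x))// ltW.
have slope := derive_lower_bound dS cS.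
have Slt x y : (S x < S y) = (x < y).
  apply/idP/idP => [|xy].
    rewrite !ltNge; apply: contra => yx; have := slope _ _ yx.
    have : 0 <= c * (x - y) by rewrite mulr_ge0 ?subr_ge0 ?(ltW c0).
    lra.
  have := slope _ _ (ltW xy); have : 0 < c * (y - x) by rewrite mulr_gt0 ?subr_gt0.
  lra.
have Sle x y : (S x <= S y) = (x <= y) by rewrite !leNgt Slt.
have [nu nuE] := @pushforward_density_measure _ _ (measurableTypeR R)
  (measurableTypeR R) R lebesgue_measure S S' mS mS' S'0.
rewrite -(@ge0_integral_transfer _ _ (measurableTypeR R) (measurableTypeR R) R
  lebesgue_measure nu S S' mS mS' S'0 nuE f mf f0).
apply: eq_measure_integral => A mA _.
apply: lebesgue_measure_unique => // _ [[a b] /= _ <-].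
rewrite nuE//.
have [Sa SaE] := surjective_derive c0 dS cS a.
have [Sb SbE] := surjective_derive c0 dS cS b.
have -> : S @^-1` `]a, b] = `]Sa, Sb]%classic.
  by apply/seteqP; split => x; rewrite /= !in_itv/= -SaE -SbE Slt Sle.
rewrite lebesgue_measure_itv/= lte_fin -SaE -SbE Slt.
case: ltP => [ab|ba]; last by rewrite set_itv_ge ?integral_set0// bnd_simp -leNgt.
rewrite integral_itv_obnd_cbnd; last first.
  exact/measurable_EFinP/measurable_funTS.
rewrite (@continuous_FTC2 _ S' S)//.
- exact: continuous_subspaceT.
- split.
  + by move=> x _; case: (dS x).
  + by apply: cvg_at_right_filter; exact: contS.
  + by apply: cvg_at_left_filter; exact: contS.
- by move=> x _; rewrite derive1E; case: (dS x).
Qed.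

(** * The standard Gaussian density *)

Definition gdens (R : realType) (x : R) : R :=
  (Num.sqrt (2 * pi))^-1 * expR (- x ^+ 2 / 2).

Lemma sqrt2pi_gt0 (R : realType) : 0 < Num.sqrt (2 * pi) :> R.
Proof. by rewrite sqrtr_gt0 mulr_gt0// pi_gt0. Qed.

Lemma normal_pdf01E (R : realType) : normal_pdf 0 1 = @gdens R.
Proof.
apply/funext => x; rewrite normal_pdfE ?oner_neq0// /normal_peak /normal_fun.
rewrite /gdens expr1n mul1r subr0 mulr_natl.
by congr (_ * expR (- _ / _)); rewrite ?mulr1n.
Qed.

Lemma gdens_gt0 (R : realType) (x : R) : 0 < gdens x.
Proof. by rewrite mulr_gt0 ?expR_gt0// invr_gt0 sqrt2pi_gt0. Qed.

Lemma continuous_gdens (R : realType) : continuous (@gdens R).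
Proof. by rewrite -normal_pdf01E; exact: continuous_normal_pdf. Qed.

Lemma measurable_gdens (R : realType) : measurable_fun setT (@gdens R).
Proof. by rewrite -normal_pdf01E; exact: measurable_normal_pdf. Qed.

Lemma gdensN (R : realType) (x : R) : gdens (- x) = gdens x.
Proof. by rewrite /gdens sqrrN. Qed.

Lemma is_derive_gdens (R : realType) (x : R) :
  is_derive x 1 (@gdens R) (- x * gdens x).
Proof.
rewrite /gdens; apply: is_derive_eq.
by rewrite /GRing.scale/=; field; rewrite gt_eqF ?sqrt2pi_gt0.
Qed.

Definition gauss1 (R : realType) : probability (measurableTypeR R) R :=
  normal_prob 0 1.

Lemma gauss1E (R : realType) (A : set R) :
  gauss1 R A = (\int[lebesgue_measure]_(x in A) (gdens x)%:E)%E.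
Proof. by rewrite /gauss1/= /normal_prob normal_pdf01E. Qed.

Lemma integral_gauss1 (R : realType) (f : R -> \bar R) :
  measurable_fun setT f -> (forall x, (0 <= f x)%E) ->
  (\int[gauss1 R]_x f x = \int[lebesgue_measure]_x (f x * (gdens x)%:E))%E.
Proof.
move=> mf f0.
apply: (@ge0_integral_transfer _ _ (measurableTypeR R) (measurableTypeR R) R
  lebesgue_measure (gauss1 R) id (@gdens R)) => //.
- exact: measurable_gdens.
- by move=> x; rewrite ltW ?gdens_gt0.
- by move=> A mA; rewrite -gauss1E.
Qed.

Lemma integrable_gdens (R : realType) :
  (@lebesgue_measure R).-integrable setT (EFin \o @gdens R).
Proof.
by have := @integrable_normal_pdf R 0 1; rewrite normal_pdf01E.
Qed.

Lemma integral_gdens (R : realType) :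
  (\int[@lebesgue_measure R]_x (gdens x)%:E = 1)%E.
Proof. by have := @integral_normal_pdf R 0 1; rewrite normal_pdf01E. Qed.

(** * Distribution functions of positive densities and monotone transport *)

Definition prob_density (R : realType) (u : R -> R) : Prop :=
  [/\ continuous u, forall x, 0 < u x &
      (\int[lebesgue_measure]_x (u x)%:E = 1)%E].

Definition dcdf (R : realType) (u : R -> R) (y : R) : R :=
  (\int[lebesgue_measure]_(z in `]-oo, y]) u z)%R.

Lemma prob_density_gdens (R : realType) : prob_density (@gdens R).
Proof.
by split; [exact: continuous_gdens|exact: gdens_gt0|exact: integral_gdens].
Qed.

Lemma integrable_prob_density (R : realType) (u : R -> R) (A : set R) :
  measurable A -> prob_density u ->
  (@lebesgue_measure R).-integrable A (EFin \o u).
Proof.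
move=> mA [cu u0 u1]; apply: (@integrableS _ _ _ _ setT) => //.
apply/integrableP; split.
  by apply/measurable_EFinP; apply: continuous_measurable_fun.
under eq_integral do rewrite /= ger0_norm ?ltW//.
by rewrite u1 ltry.
Qed.

Lemma dcdfE (R : realType) (u : R -> R) (y : R) : prob_density u ->
  (dcdf u y)%:E = (\int[lebesgue_measure]_(z in `]-oo, y]) (u z)%:E)%E.
Proof.
move=> du; rewrite /dcdf /Rintegral fineK//.
by apply: integrable_fin_num => //; exact: integrable_prob_density.
Qed.

Lemma is_derive_dcdf (R : realType) (u : R -> R) (x : R) : prob_density u ->
  is_derive x 1 (dcdf u) (u x).
Proof.
move=> du; have [cu _ _] := du.
have x1 : x < x + 1 by rewrite ltrDl.
have Nyx : (-oo%O < BRight x)%E by rewrite ltNyr.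
have iu := integrable_prob_density (measurable_itv `]-oo, (x + 1)]) du.
have [d1 d2] := continuous_FTC1 x1 iu Nyx (cu x).
by apply: DeriveDef; [exact: d1|rewrite -derive1E].
Qed.

Lemma continuous_dcdf (R : realType) (u : R -> R) : prob_density u ->
  continuous (dcdf u).
Proof. by move=> du x; exact: is_derive1_continuous (is_derive_dcdf x du). Qed.

Lemma dcdf_lt (R : realType) (u : R -> R) (x y : R) : prob_density u ->
  (dcdf u x < dcdf u y) = (x < y).
Proof.
move=> du; have [_ u0 _] := du.
have H a b : a < b -> dcdf u a < dcdf u b.
  move=> ab; have cont : {within `[a, b], continuous (dcdf u)}.
    by apply: continuous_subspaceT; exact: continuous_dcdf.
  have [z _ E] := MVT ab (fun z _ => is_derive_dcdf z du) cont.
  by rewrite -subr_gt0 E mulr_gt0// subr_gt0.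
apply/idP/idP; last exact: H.
by case: (ltrgtP x y) => // [/H yx /(lt_trans yx)|->]; rewrite ltxx.
Qed.

(** Continuity of the measure with density [u] along half-lines gives values of
    the distribution function on both sides of [p]. *)
Lemma dcdf_surj (R : realType) (u : R -> R) (p : R) : prob_density u ->
  0 < p < 1 -> exists y, dcdf u y = p.
Proof.
move=> du /andP[p0 p1]; have [cu u0 u1] := du.
have mu := continuous_measurable_fun cu.
have [nu nuE] := @pushforward_density_measure _ _ (measurableTypeR R)
  (measurableTypeR R) R lebesgue_measure id u (@measurable_id _ _ _) mu
  (fun x => ltW (u0 x)).
have nuD y : nu `]-oo, y]%classic = (dcdf u y)%:E by rewrite nuE// dcdfE.
have nuT : nu setT = 1%E by rewrite nuE// preimage_setT.
have [a /= pa] : exists a, p < dcdf u a.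
  have : nu `]-oo, n%:R]%classic @[n --> \oo] --> (1 : \bar R)%E.
    rewrite -nuT (_ : setT = \bigcup_n (fun n => `]-oo, n%:R]%classic) n).
      apply: nondecreasing_cvg_mu => //; first exact: bigcup_measurable.
      move=> n m nm; apply/subsetPset => x/=; rewrite !in_itv/= => /le_trans.
      by apply; rewrite ler_nat.
    apply/esym; rewrite -subTset => t _/=.
    by exists (Num.truncn t).+1; rewrite //= in_itv/= ltW// truncnS_gt.
  under eq_fun do rewrite nuD.
  move/fine_cvgP => [_]; move/cvgr_gt => /(_ p p1)[N _ /(_ N (leqnn N))].
  by exists N%:R.
have [b /= pb] : exists b, dcdf u b < p.
  have : nu `]-oo, (- n%:R)]%classic @[n --> \oo] --> (0 : \bar R)%E.
    rewrite -(measure0 nu) (_ : set0 = \bigcap_n (fun n => `]-oo, (- n%:R)]%classic) n).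
      apply: nonincreasing_cvg_mu => //; first by rewrite nuD ltry.
        exact: bigcap_measurable.
      move=> n m nm; apply/subsetPset => x/=; rewrite !in_itv/= => /le_trans.
      by apply; rewrite lerN2 ler_nat.
    apply/esym; rewrite -subset0 => t /(_ (Num.truncn (- t)).+1 I) /=.
    by rewrite in_itv/= leNgt => /negP; apply; rewrite ltrNl truncnS_gt.
  under eq_fun do rewrite nuD.
  move/fine_cvgP => [_]; move/cvgr_lt => /(_ p p0)[N _ /(_ N (leqnn N))].
  by exists (- N%:R).
have ba : b <= a by rewrite ltW// -(dcdf_lt _ _ du) (lt_trans pb).
have cont : {within `[b, a], continuous (dcdf u)}.
  by apply: continuous_subspaceT; exact: continuous_dcdf.
have [|x _ xp] := IVT ba cont (v := p); last by exists x.
by rewrite ge_min ltW//= le_max (ltW pa) orbT.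
Qed.

Lemma dcdf_itv (R : realType) (u : R -> R) (y : R) : prob_density u ->
  0 < dcdf u y < 1.
Proof.
move=> du; have [cu u0 u1] := du.
have ge0 x : 0 <= dcdf u x by apply: Rintegral_ge0 => z _; exact: ltW.
have le1 x : dcdf u x <= 1.
  rewrite -lee_fin dcdfE// -u1; apply: ge0_subset_integral => //.
    by apply/measurable_EFinP; apply: continuous_measurable_fun.
  by move=> z _; rewrite lee_fin ltW.
apply/andP; split.
  by apply: le_lt_trans (ge0 (y - 1)) _; rewrite dcdf_lt// ltrBlDr ltrDl.
by apply: lt_le_trans (le1 (y + 1)); rewrite dcdf_lt// ltrDl.
Qed.

Lemma dcdf_compl (R : realType) (u : R -> R) (y : R) : prob_density u ->
  (1 - dcdf u y)%:E = (\int[lebesgue_measure]_(z in `]y, +oo[) (u z)%:E)%E.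
Proof.
move=> du; have [cu u0 u1] := du.
have mu := continuous_measurable_fun cu.
rewrite EFinB dcdfE// -u1 -[X in (\int[_]_(x in X) _ - _)%E](@setUv _ `]-oo, y]).
rewrite ge0_integral_setU//=.
- by rewrite setCitvl -(dcdfE y du) [X in (X - _)%E]addeC addeK.
- exact: measurableC.
- exact/measurable_EFinP/measurable_funTS.
- by move=> x _; rewrite lee_fin ltW.
- by apply/disj_setPCl.
Qed.

(** [T] is the inverse of the distribution function of [v] composed with that of
    [u]; its derivative is that of an inverse function. *)
Lemma monotone_transport (R : realType) (u v : R -> R) :
  prob_density u -> prob_density v ->
  exists T : R -> R, (forall x, dcdf v (T x) = dcdf u x) /\
    (forall x : R, is_derive x 1 T (u x / v (T x))).
Proof.
move=> du dv; have [cu u0 _] := du; have [cv v0 _] := dv.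
pose T x := xget 0 [set y | dcdf v y = dcdf u x].
have TE x : dcdf v (T x) = dcdf u x.
  have [y yE] := dcdf_surj dv (dcdf_itv x du).
  by rewrite /T; case: xgetP => [z _ //|/(_ y)]; rewrite /= yE.
exists T; split=> // x.
pose G := fun p => xget 0 [set y | dcdf v y = p].
have vK : cancel (dcdf v) G.
  move=> y; rewrite /G; case: xgetP => [z _ /= zy|/(_ y) []//].
  by apply/le_anti; rewrite !leNgt -(dcdf_lt z y dv) -(dcdf_lt y z dv) zy ltxx.
have dG : is_derive (dcdf v (T x)) 1 G (v (T x))^-1.
  apply: is_derive_inverse.
  - by near=> z; exact: vK.
  - by near=> z; exact: continuous_dcdf.
  - exact: is_derive_dcdf.
  - by rewrite gt_eqF.
rewrite TE in dG.
have -> : T = G \o dcdf u by [].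
have := is_derive1_comp dG (is_derive_dcdf x du).
by rewrite mulrC.
Unshelve. all: by end_near. Qed.

(** * Convex functions of one variable *)

Definition convex1 (R : realType) (f : R -> R) : Prop :=
  forall l x y : R, 0 < l < 1 ->
    f ((1 - l) * x + l * y) <= (1 - l) * f x + l * f y.

Lemma convex1_chord (R : realType) (f : R -> R) (x y z : R) : convex1 f ->
  x < y < z -> (f y - f x) * (z - y) <= (f z - f y) * (y - x).
Proof.
move=> cf /andP[xy yz]; have xz : 0 < z - x by lra.
have h : 0 < (y - x) / (z - x) < 1.
  by apply/andP; split; [rewrite divr_gt0// subr_gt0|rewrite ltr_pdivrMr// mul1r; lra].
have := cf _ x z h.
have -> : (1 - (y - x) / (z - x)) * x + (y - x) / (z - x) * z = y.
  by field; rewrite gt_eqF.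
rewrite -(ler_pM2r xz).
have -> : ((1 - (y - x) / (z - x)) * f x + (y - x) / (z - x) * f z) * (z - x)
  = (z - y) * f x + (y - x) * f z by field; rewrite gt_eqF.
lra.
Qed.

(** The supremum of the slopes to the left of [y] is a subgradient. *)
Lemma convex1_subgradient (R : realType) (f : R -> R) (y : R) : convex1 f ->
  exists a, forall z, f y + a * (z - y) <= f z.
Proof.
move=> cf; pose E := [set (f y - f z) / (y - z) | z in [set z | z < y]].
have ub w : y < w -> ubound E ((f w - f y) / (w - y)).
  move=> yw _ [z /= zy <-].
  rewrite ler_pdivrMr ?subr_gt0// mulrAC ler_pdivlMr ?subr_gt0//.
  by apply: convex1_chord => //; rewrite zy.
have E0 : E !=set0 by exists ((f y - f (y - 1)) / (y - (y - 1))), (y - 1) => //=;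
  rewrite ltrBlDr ltrDl.
have hsE : has_sup E.
  by split => //; exists ((f (y + 1) - f y) / (y + 1 - y)); apply: ub; rewrite ltrDl.
exists (sup E) => z; have [zy|yz|->] := ltrgtP z y; last by rewrite subrr mulr0 addr0.
- have : (f y - f z) / (y - z) <= sup E.
    by apply: ub_le_sup; [exact: hsE.2|exists z].
  by rewrite ler_pdivrMr ?subr_gt0//; lra.
- have : sup E <= (f z - f y) / (z - y) by apply: ge_sup => //; exact: ub.
  by rewrite ler_pdivlMr ?subr_gt0//; lra.
Qed.

Lemma convex1_lipschitz_at (R : realType) (f : R -> R) (y : R) : convex1 f ->
  exists2 C : R, 0 < C &
    forall z : R, `|z - y| < 1 -> `|f z - f y| <= C * `|z - y|.
Proof.
move=> cf; have [a aP] := convex1_subgradient y cf.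
have na := normr_ge0 a; have np := normr_ge0 (f (y + 1) - f y).
have nm := normr_ge0 (f (y - 1) - f y).
exists (`|a| + `|f (y + 1) - f y| + `|f (y - 1) - f y| + 1); first lra.
move=> z; have sub := aP z.
have [zy|yz|->] := ltrgtP z y; last by rewrite !subrr normr0 mulr0.
- move=> h.
  have h2 : y - 1 < z < y by rewrite zy andbT; lra.
  have ch := convex1_chord cf h2.
  have k1 := ler_norm (f (y - 1) - f y).
  have k2 := ler_norm a.
  have k4 : 0 < y - z by lra.
  rewrite ler_norml; apply/andP; split; nra.
- move=> h.
  have h2 : y < z < y + 1 by rewrite yz /=; lra.
  have ch := convex1_chord cf h2.
  have k1 := ler_norm (f (y + 1) - f y).
  have k2 := ler_norm (- a); rewrite normrN in k2.
  have k4 : 0 < z - y by lra.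
  rewrite ler_norml; apply/andP; split; nra.
Qed.

(** Free energies of sections are shown to be convex, and this is how they are
    known to be continuous, which monotone transport requires. *)
Lemma convex1_continuous (R : realType) (f : R -> R) : convex1 f -> continuous f.
Proof.
move=> cf y; have [C C0 bnd] := convex1_lipschitz_at y cf.
apply/cvgrPdist_lt => e e0; apply/nbhs_ballP.
have eC : 0 < e / C by rewrite divr_gt0.
exists (Num.min 1 (e / C)) => /=; first by rewrite lt_min ltr01 eC.
move=> z; rewrite /ball/= lt_min distrC => /andP[z1 zC].
by rewrite distrC (le_lt_trans (bnd z z1))// mulrC -ltr_pdivlMr.
Qed.

(** * Two inequalities for the exponential *)

Lemma expR_ge_tangent (R : realType) (a b : R) :
  expR b * (1 + a - b) <= expR a.
Proof.
rewrite -[in leRHS](subrK b a) expRD mulrC ler_wpM2r ?expR_ge0//.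
by rewrite -addrA expR_ge1Dx.
Qed.

(** Convexity of the exponential between [0] and [t], from its tangent at
    [l * t]. *)
Lemma expR_mix (R : realType) (l t : R) : 0 <= l <= 1 ->
  expR (l * t) <= (1 - l) + l * expR t.
Proof.
move=> /andP[l0 l1].
have h0 := expR_ge_tangent 0 (l * t); have h1 := expR_ge_tangent t (l * t).
rewrite expR0 in h0.
have := ler_wpM2l l0 h1; have l1' : 0 <= 1 - l by lra.
have := ler_wpM2l l1' h0; nra.
Qed.

(** With [expR t] the derivative of a contraction, the right-hand side is the
    derivative of the map interpolating with weight [e] between the identity and
    that contraction.  Its logarithm is at least [e * t] only; trading [e * t]
    for [e ^+ 2 * t] costs the term [(e - e ^+ 2) * (1 - expR t)], which has the
    form of a derivative and disappears in gauss_jensen.  The difference of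
    logarithms vanishes at [t = 0] and is nonincreasing. *)
Lemma expR_interpolation (R : realType) (e t : R) : 0 <= e <= 1 -> t <= 0 ->
  expR (e ^+ 2 * t - (e - e ^+ 2) * (1 - expR t)) <= (1 - e) + e * expR t.
Proof.
move=> /andP[e0 e1] t0; have q0 := expR_gt0 t.
have [e1'|e1'] := eqVneq e 1.
  by rewrite e1' expr1n mul1r !subrr mul0r subr0 mul1r add0r.
have {}e1 : e < 1 by rewrite lt_neqAle e1' e1.
have p0 s : 0 < (1 - e) + e * expR s.
  by have := expR_ge0 s => s0; have := mulr_ge0 e0 s0; lra.
rewrite -[leRHS]lnK ?posrE// ler_expR.
move: t0; rewrite le_eqVlt => /predU1P[->|t0].
  by rewrite expR0 subrr !mulr0 subr0 mulr1 subrK ln1.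
pose G s := ln ((1 - e) + e * expR s) - e ^+ 2 * s + (e - e ^+ 2) * (1 - expR s).
have dG (s : R) : is_derive s 1 G
    (e * expR s / ((1 - e) + e * expR s) - e ^+ 2 - (e - e ^+ 2) * expR s).
  have ps := p0 s.
  have dln := is_derive1_ln ps.
  have dE : is_derive s 1 (fun s => (1 - e) + e * expR s) (e * expR s).
    by apply: is_derive_eq; rewrite /GRing.scale/=; ring.
  have dC := @is_derive1_comp _ (@ln R) _ s _ _ dln dE.
  by rewrite /G; apply: is_derive_eq; rewrite /GRing.scale/=; field; rewrite gt_eqF.
have cont : {within `[t, 0], continuous G}.
  by apply: continuous_subspaceT => s; exact: is_derive1_continuous (dG s).
have [s st E] := MVT t0 (fun s _ => dG s) cont.
have G0 : G 0 = 0 by rewrite /G expR0 subrr !mulr0 subr0 addr0 mulr1 subrK ln1.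
have D0 : e * expR s / ((1 - e) + e * expR s) - e ^+ 2 - (e - e ^+ 2) * expR s <= 0.
  have ps := p0 s; rewrite -(pmulr_lle0 _ ps).
  have -> : (e * expR s / (1 - e + e * expR s) - e ^+ 2 - (e - e ^+ 2) * expR s)
      * (1 - e + e * expR s) = - (e ^+ 2 * (1 - e) * (1 - expR s) ^+ 2).
    by field; rewrite gt_eqF.
  rewrite oppr_le0 mulr_ge0 ?sqr_ge0// mulr_ge0 ?sqr_ge0//; lra.
have : 0 <= G t.
  rewrite G0 sub0r in E; rewrite -oppr_le0 E sub0r.
  by rewrite mulr_le0_ge0// oppr_ge0 ltW.
rewrite /G; lra.
Qed.

(** * Free energy, and the Prekopa-Leindler inequality on the line *)

Definition laplace d (T : measurableType d) (R : realType)
    (mu : probability T R) (f : T -> R) : R :=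
  fine (\int[mu]_x (expR (- f x))%:E).

Definition free_energy d (T : measurableType d) (R : realType)
  (mu : probability T R) (f : T -> R) : R := - ln (laplace mu f).

Lemma measurable_expRN d (T : measurableType d) (R : realType) (f : T -> R) :
  measurable_fun setT f -> measurable_fun setT (fun x => expR (- f x)).
Proof.
by move=> mf; apply: measurableT_comp => //; exact: measurableT_comp.
Qed.

Lemma integral_expRN_le1 d (T : measurableType d) (R : realType)
    (mu : probability T R) (f : T -> R) :
  measurable_fun setT f -> (forall x, 0 <= f x) ->
  (\int[mu]_x (expR (- f x))%:E <= 1)%E.
Proof.
move=> mf f0; have := probability_setT mu => <-.
rewrite -[leRHS]mul1e -integral_cst//; apply: ge0_le_integral => //.
- by apply/measurable_EFinP; exact: measurable_expRN.
- by move=> x _; rewrite lee_fin -expR0 ler_expR oppr_le0.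
Qed.

Lemma laplaceE d (T : measurableType d) (R : realType)
    (mu : probability T R) (f : T -> R) :
  measurable_fun setT f -> (forall x, 0 <= f x) ->
  (laplace mu f)%:E = (\int[mu]_x (expR (- f x))%:E)%E.
Proof.
move=> mf f0; rewrite /laplace fineK// ge0_fin_numE.
  by rewrite (le_lt_trans (integral_expRN_le1 mu mf f0)) ?ltry.
by apply: integral_ge0 => x _; rewrite lee_fin expR_ge0.
Qed.

Lemma laplace_le1 d (T : measurableType d) (R : realType)
    (mu : probability T R) (f : T -> R) :
  measurable_fun setT f -> (forall x, 0 <= f x) -> laplace mu f <= 1.
Proof.
by move=> mf f0; rewrite -lee_fin laplaceE// integral_expRN_le1.
Qed.

(** An integral of a positive function vanishes only for the zero measure. *)
Lemma laplace_gt0 d (T : measurableType d) (R : realType)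
    (mu : probability T R) (f : T -> R) :
  measurable_fun setT f -> (forall x, 0 <= f x) -> 0 < laplace mu f.
Proof.
move=> mf f0; rewrite lt_neqAle; apply/andP; split; last first.
  by rewrite -lee_fin laplaceE//; apply: integral_ge0 => x _; rewrite lee_fin expR_ge0.
apply/eqP => L0; have := laplaceE mu mf f0; rewrite -L0 => I0.
have mE : measurable_fun setT (fun x => (expR (- f x))%:E).
  by apply/measurable_EFinP; exact: measurable_expRN.
have := (ae_eq_integral_abs mu measurableT mE).1.
have -> : (\int[mu]_x `|(expR (- f x))%:E| = 0)%E.
  by rewrite -[RHS]/(0%:E) I0; apply: eq_integral => x _; rewrite gee0_abs// lee_fin expR_ge0.
move=> /(_ erefl) [N [mN N0 subN]].
have : mu setT = 0%E.
  apply/eqP; rewrite eq_le measure_ge0 andbT -N0.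
  apply: le_measure; rewrite ?inE// => x _; apply: subN => /= /(_ I) [].
  by move/eqP; rewrite gt_eqF// expR_gt0.
by rewrite probability_setT => /eqP; rewrite onee_eq0.
Qed.

Lemma laplace_free_energy d (T : measurableType d) (R : realType)
    (mu : probability T R) (f : T -> R) :
  measurable_fun setT f -> (forall x, 0 <= f x) ->
  expR (- free_energy mu f) = laplace mu f.
Proof. by move=> mf f0; rewrite opprK lnK// posrE laplace_gt0. Qed.

Lemma free_energy_ge0 d (T : measurableType d) (R : realType)
    (mu : probability T R) (f : T -> R) :
  measurable_fun setT f -> (forall x, 0 <= f x) -> 0 <= free_energy mu f.
Proof. by move=> mf f0; rewrite oppr_ge0 ln_le0// laplace_le1. Qed.

Lemma free_energy_le d (T : measurableType d) (R : realType)
    (mu : probability T R) (f : T -> R) (a : R) :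
  measurable_fun setT f -> (forall x, 0 <= f x) ->
  ((expR (- a))%:E <= \int[mu]_x (expR (- f x))%:E)%E -> free_energy mu f <= a.
Proof.
move=> mf f0; rewrite -laplaceE// lee_fin -laplace_free_energy//.
by rewrite ler_expR lerN2.
Qed.

(** The probability density proportional to [expR (- f)] times the Gaussian
    density. *)
Definition gibbs (R : realType) (f : R -> R) (x : R) : R :=
  expR (free_energy (gauss1 R) f - f x) * gdens x.

Lemma prob_density_gibbs (R : realType) (f : R -> R) :
  continuous f -> (forall x, 0 <= f x) -> prob_density (gibbs f).
Proof.
move=> cf f0; have mf := continuous_measurable_fun cf; split.
- move=> x; apply: cvgM; last exact: continuous_gdens.
  apply: (cvg_comp _ expR); last exact: continuous_expR.
  by apply: cvgB; [exact: cvg_cst|exact: cf].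
- by move=> x; rewrite mulr_gt0 ?expR_gt0 ?gdens_gt0.
- under eq_integral do rewrite /gibbs expRD -mulrA EFinM.
  rewrite ge0_integralZl//; last 2 first.
  + apply/measurable_EFinP/measurable_funM; last exact: measurable_gdens.
    exact: measurable_expRN.
  + by move=> x _; rewrite lee_fin mulr_ge0 ?expR_ge0// ltW ?gdens_gt0.
  under eq_integral do rewrite EFinM.
  rewrite -integral_gauss1; last 2 first.
  + by apply/measurable_EFinP; exact: measurable_expRN.
  + by move=> x; rewrite lee_fin expR_ge0.
  rewrite -laplaceE// -laplace_free_energy// -EFinM -expRD subrr expR0//.
Qed.

Lemma gibbsE (R : realType) (f : R -> R) (x : R) :
  gibbs f x = (Num.sqrt (2 * pi))^-1 *
    expR (free_energy (gauss1 R) f - f x - x ^+ 2 / 2).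
Proof. by rewrite /gibbs /gdens mulrCA -expRD mulNr. Qed.

(** The derivative of the monotone map [T] is written [expR (t x)], because only
    its logarithm [t], which is explicit in terms of [f], [g] and [T], is used
    afterwards. *)
Lemma gibbs_transport (R : realType) (f g : R -> R) :
  continuous f -> (forall x, 0 <= f x) -> continuous g -> (forall x, 0 <= g x) ->
  exists T t : R -> R,
    [/\ forall x : R, is_derive x 1 T (expR (t x)),
        continuous (fun x => expR (t x)),
        forall x, dcdf (gibbs g) (T x) = dcdf (gibbs f) x,
        forall x, gibbs f x = gibbs g (T x) * expR (t x) &
        forall x, t x = free_energy (gauss1 R) f - f x - x ^+ 2 / 2
          - (free_energy (gauss1 R) g - g (T x) - (T x) ^+ 2 / 2)].
Proof.
move=> cf f0 cg g0.
have df := prob_density_gibbs cf f0; have dg := prob_density_gibbs cg g0.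
have [T [TE dT]] := monotone_transport df dg.
pose t x := free_energy (gauss1 R) f - f x - x ^+ 2 / 2
          - (free_energy (gauss1 R) g - g (T x) - (T x) ^+ 2 / 2).
have tE x : gibbs f x / gibbs g (T x) = expR (t x).
  have c0 : (Num.sqrt (2 * pi))^-1 != 0 :> R by rewrite invr_eq0 gt_eqF ?sqrt2pi_gt0.
  by rewrite !gibbsE invfM mulrACA divff// mul1r -expRB.
exists T, t; split=> //.
- by move=> x; rewrite -tE.
- under eq_fun do rewrite -tE.
  have [cgf _ _] := df; have [cgg gg0 _] := dg => x.
  apply: cvgM; first exact: cgf.
  apply: cvgV; first by rewrite gt_eqF.
  apply: (cvg_comp _ (gibbs g)); last exact: cgg.
  exact: is_derive1_continuous (dT x).
- move=> x; rewrite -tE mulrCA divff ?mulr1//.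
  by rewrite gt_eqF//; have [_ gg0 _] := dg.
Qed.

(** Let [T] carry the density of [f] to that of [g] and substitute
    [S x = (1 - l) x + l T x] in the integral of [expR (- h)].  The derivative
    of [S] is at least the power [l] of that of [T] (expR_mix) and the square is
    convex, so the integrand dominates the constant
    [expR (- ((1 - l) A(f) + l A(g)))] times the density of [f], which has
    integral one. *)
Lemma prekopa_leindler1 (R : realType) (l : R) (f g h : R -> R) : 0 < l < 1 ->
  continuous f -> (forall x, 0 <= f x) -> continuous g -> (forall x, 0 <= g x) ->
  measurable_fun setT h -> (forall x, 0 <= h x) ->
  (forall x y : R, h ((1 - l) * x + l * y) <= (1 - l) * f x + l * g y) ->
  free_energy (gauss1 R) h
    <= (1 - l) * free_energy (gauss1 R) f + l * free_energy (gauss1 R) g.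
Proof.
move=> /andP[l0 l1] cf f0 cg g0 mh h0 hfg.
have [T [t [dT ct _ _ tE]]] := gibbs_transport cf f0 cg g0.
set a := free_energy (gauss1 R) f in tE *; set b := free_energy (gauss1 R) g in tE *.
apply: free_energy_le => //.
rewrite integral_gauss1; last 2 first.
- by apply/measurable_EFinP; exact: measurable_expRN.
- by move=> x; rewrite lee_fin expR_ge0.
pose S (x : R) : R := (1 - l) * x + l * T x.
pose S' (x : R) : R := (1 - l) + l * expR (t x).
have dS (x : R) : is_derive x 1 S (S' x).
  by apply: is_derive_eq; rewrite /GRing.scale/= /S'; ring.
have cS' : continuous S'.
  by move=> x; apply: cvgD; [exact: cvg_cst|apply: cvgM; [exact: cvg_cst|exact: ct]].
have S'l x : 1 - l <= S' x by rewrite lerDl mulr_ge0 ?expR_ge0// ltW.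
have l1' : 0 < 1 - l by lra.
rewrite (change_of_variables l1' dS cS' S'l); last 2 first.
- apply/measurable_EFinP/measurable_funM; last exact: measurable_gdens.
  exact: measurable_expRN.
- by move=> x; rewrite lee_fin mulr_ge0 ?expR_ge0// ltW ?gdens_gt0.
have [cgf gf0 gf1] := prob_density_gibbs cf f0.
have -> : (expR (- ((1 - l) * a + l * b)))%:E =
    (\int[lebesgue_measure]_x (expR (- ((1 - l) * a + l * b)) * gibbs f x)%:E)%E.
  under eq_integral do rewrite EFinM.
  rewrite ge0_integralZl// ?gf1 ?mule1//.
  - by apply/measurable_EFinP; apply: continuous_measurable_fun.
  - by move=> x _; rewrite lee_fin ltW.
apply: ge0_le_integral => //.
- by move=> x _; rewrite lee_fin mulr_ge0 ?expR_ge0// ltW.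
- apply/measurable_EFinP/measurable_funM => //.
  exact: continuous_measurable_fun.
- apply/measurable_EFinP; apply: measurable_funM.
    apply: measurable_funM.
      apply: measurableT_comp => //; apply: measurableT_comp => //.
      apply: measurableT_comp => //.
      by apply: continuous_measurable_fun => x; exact: is_derive1_continuous (dS x).
    apply: measurableT_comp; first exact: measurable_gdens.
    by apply: continuous_measurable_fun => x; exact: is_derive1_continuous (dS x).
  exact: continuous_measurable_fun.
- move=> x _; rewrite -!EFinM lee_fin /gdens.
  have c0 : 0 < (Num.sqrt (2 * pi))^-1 :> R by rewrite invr_gt0 sqrt2pi_gt0.
  have le1 := expR_mix (t x) (_ : 0 <= l <= 1).
  have {}le1 : expR (l * t x) <= S' x by apply: le1; rewrite !ltW.
  apply: (@le_trans _ _ (expR (- h (S x)) *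
    ((Num.sqrt (2 * pi))^-1 * expR (- S x ^+ 2 / 2)) * expR (l * t x))); last first.
    by rewrite ler_wpM2l// mulr_ge0 ?expR_ge0// mulr_ge0 ?expR_ge0// ltW.
  rewrite gibbsE -/a mulrCA -expRD.
  rewrite [leRHS](_ : _ = (Num.sqrt (2 * pi))^-1 *
    expR (- h (S x) + (- S x ^+ 2 / 2) + l * t x)); last first.
    by rewrite 2!expRD; ring.
  rewrite ler_pM2l// ler_expR tE.
  have := hfg x (T x); rewrite -/(S x).
  have : S x ^+ 2 <= (1 - l) * x ^+ 2 + l * T x ^+ 2.
    have : 0 <= l * (1 - l) * (x - T x) ^+ 2.
      by rewrite mulr_ge0 ?sqr_ge0// mulr_ge0 ?ltW.
    by rewrite /S; move: (T x) (x : R) (l) => *; lra.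
  move: (h (S x)) (f x) (g (T x)) (S x) (T x) (x : R) (a) (b) (l) => *; lra.
Qed.

(** * Contraction of the Gaussian onto its log-concave perturbations *)

Lemma ge0_integral_translate (R : realType) (w : R) (A : set R) (f : R -> R) :
  measurable A -> measurable_fun setT f -> (forall x, 0 <= f x) ->
  (\int[lebesgue_measure]_(x in A) (f x)%:E =
   \int[lebesgue_measure]_(z in (fun z => z + w)%R @^-1` A) (f (z + w))%:E)%E.
Proof.
move=> mA mf f0.
have dS (x : R) : is_derive x 1 (fun z => z + w) 1.
  by apply: is_derive_eq; rewrite addr0.
rewrite integral_mkcond [RHS]integral_mkcond.
rewrite (change_of_variables ltr01 dS); last 4 first.
- exact: cst_continuous.
- by move=> _.
- apply/(measurable_restrictT _ _).1 => //.
  exact/measurable_EFinP/measurable_funTS.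
- by move=> y; rewrite patchE; case: ifP => // _; rewrite lee_fin.
apply: eq_integral => x _; rewrite mule1 !patchE/=.
have [xA|xA] := boolP (x + w \in A).
  by rewrite mem_set//; move: xA; rewrite inE.
by rewrite memNset//; move: xA; rewrite notin_setE.
Qed.

(** Both tails are needed in convex1_contraction, which uses one or the other
    according to the order of two points. *)
Lemma le_dcdf_gdens (R : realType) (a y : R) (C : R) (u : R -> R) : 0 <= C ->
  prob_density u -> (forall z, u z <= C * gdens (z + a)) ->
  dcdf u y <= C * dcdf (@gdens R) (y + a) /\
  1 - dcdf u y <= C * (1 - dcdf (@gdens R) (y + a)).
Proof.
move=> C0 du uC; have [cu u0 _] := du; have dg := prob_density_gdens R.
have mu := continuous_measurable_fun cu.
have mg : measurable_fun setT (fun z : R => gdens (z + a)).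
  by apply: measurableT_comp; [exact: measurable_gdens|exact: measurable_funD].
have g0 (z : R) : 0 <= gdens z by rewrite ltW ?gdens_gt0.
have key A : measurable A -> (\int[lebesgue_measure]_(z in A) (u z)%:E
    <= C%:E * \int[lebesgue_measure]_(z in A) (gdens (z + a))%:E)%E.
  move=> mA; rewrite -ge0_integralZl//; last 2 first.
  - exact/measurable_EFinP/measurable_funTS.
  - by move=> z _; rewrite lee_fin.
  apply: ge0_le_integral => //.
  - by move=> z _; rewrite lee_fin ltW.
  - exact/measurable_EFinP/measurable_funTS.
  - by apply/measurable_EFinP/measurable_funTS/measurable_funM.
  - by move=> z _; rewrite -EFinM lee_fin.
split; rewrite -lee_fin EFinM.
- rewrite !dcdfE// (ge0_integral_translate a _ (@measurable_gdens R))//.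
  rewrite (_ : _ @^-1` _ = `]-oo, y]%classic); first exact: key.
  by apply/seteqP; split => z; rewrite /= !in_itv/= lerD2r.
- rewrite !dcdf_compl// (ge0_integral_translate a _ (@measurable_gdens R))//.
  rewrite (_ : _ @^-1` _ = `]y, +oo[%classic); first exact: key.
  by apply/seteqP; split => z; rewrite /= !in_itv/= !andbT ltrD2r.
Qed.

(** Cross-multiplied form of two facts: the ratio of the density to the
    distribution function is nonincreasing, and the ratio of the density to the
    tail is nondecreasing.  After translating the integrals to a common
    half-line ending at [0] they compare
    [gdens x * gdens (z + w)] with [gdens w * gdens (z + x)] pointwise, where the
    exponents differ by [z * (x - w)]. *)
Lemma gdens_hazard (R : realType) (w x : R) : w <= x ->
  gdens x * dcdf (@gdens R) w <= gdens w * dcdf (@gdens R) x /\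
  gdens w * (1 - dcdf (@gdens R) x) <= gdens x * (1 - dcdf (@gdens R) w).
Proof.
move=> wx; have dg := prob_density_gdens R.
have g0 (z : R) : 0 <= gdens z by rewrite ltW ?gdens_gt0.
have mg c : measurable_fun setT (fun z : R => gdens (z + c)).
  by apply: measurableT_comp; [exact: measurable_gdens|exact: measurable_funD].
have key (A : set R) (a b : R) : measurable A -> (forall z, A z -> 0 <= z * (a - b)) ->
    ((gdens b)%:E * \int[lebesgue_measure]_(z in A) (gdens (z + a))%:E
    <= (gdens a)%:E * \int[lebesgue_measure]_(z in A) (gdens (z + b))%:E)%E.
  move=> mA Az; have kz c c' : ((gdens c)%:E * \int[lebesgue_measure]_(z in A)
      (gdens (z + c'))%:E = \int[lebesgue_measure]_(z in A)
      (gdens c * gdens (z + c'))%:E)%E.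
    under [RHS]eq_integral do rewrite EFinM.
    rewrite ge0_integralZl ?lee_fin//.
      by apply/measurable_EFinP/measurable_funTS; exact: mg.
    by move=> z _; rewrite lee_fin.
  rewrite !kz.
  apply: ge0_le_integral => //.
  - by move=> z _; rewrite lee_fin mulr_ge0.
  - by apply/measurable_EFinP/measurable_funTS/measurable_funM => //; exact: mg.
  - by apply/measurable_EFinP/measurable_funTS/measurable_funM => //; exact: mg.
  - move=> z /Az za; rewrite lee_fin /gdens.
    have c0 : 0 < (Num.sqrt (2 * pi))^-1 :> R by rewrite invr_gt0 sqrt2pi_gt0.
    rewrite mulrACA [leRHS]mulrACA ler_pM2l ?mulr_gt0//.
    by rewrite -!expRD ler_expR; nra.
split; rewrite -lee_fin !EFinM.
- rewrite !dcdfE// (ge0_integral_translate w _ (@measurable_gdens R))//.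
  rewrite (ge0_integral_translate x _ (@measurable_gdens R))//.
  rewrite (_ : _ @^-1` _ = `]-oo, 0]%classic); last first.
    by apply/seteqP; split => z; rewrite /= !in_itv/= gerDr.
  rewrite (_ : _ @^-1` _ = `]-oo, 0]%classic); last first.
    by apply/seteqP; split => z; rewrite /= !in_itv/= gerDr.
  by apply: key => // z; rewrite /= in_itv/= => z0; nra.
- rewrite !dcdf_compl// (ge0_integral_translate x _ (@measurable_gdens R))//.
  rewrite (ge0_integral_translate w _ (@measurable_gdens R))//.
  rewrite (_ : _ @^-1` _ = `]0, +oo[%classic); last first.
    by apply/seteqP; split => z; rewrite /= !in_itv/= !andbT ltrDr.
  rewrite (_ : _ @^-1` _ = `]0, +oo[%classic); last first.
    by apply/seteqP; split => z; rewrite /= !in_itv/= !andbT ltrDr.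
  by apply: key => // z; rewrite /= in_itv/= andbT => z0; nra.
Qed.

(** The inequality says that the monotone map from the Gaussian to [gibbs k],
    sending [x] to [y], has derivative at most one at [x].  Replacing [k] by its
    tangent at [y] bounds [gibbs k] by a multiple of a translated Gaussian
    density, with equality at [y].  So both tails of [gibbs k] at [y] are at most
    this multiple of the tails of the Gaussian at some [w], and the density at
    [y] is the same multiple of [gdens w]; the tails of [gibbs k] at [y] being
    those of the Gaussian at [x], gdens_hazard compares [gdens w] with [gdens x],
    on one tail or the other according to the position of [w]. *)
Lemma convex1_contraction (R : realType) (k : R -> R) (x y : R) :
  convex1 k -> (forall z, 0 <= k z) ->
  dcdf (gibbs k) y = dcdf (@gdens R) x -> gdens x <= gibbs k y.
Proof.
move=> ck k0 E; have [a aP] := convex1_subgradient y ck.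
have dk := prob_density_gibbs (convex1_continuous ck) k0.
have dg := prob_density_gdens R.
pose b := free_energy (gauss1 R) k.
pose C := expR (b - k y + a * y + a ^+ 2 / 2).
have gC z : C * gdens (z + a) = (Num.sqrt (2 * pi))^-1 *
    expR (b - (k y + a * (z - y)) - z ^+ 2 / 2).
  by rewrite /C /gdens mulrCA -expRD; congr (_ * expR _); field.
have [|lo hi] := @le_dcdf_gdens R a y C (gibbs k) (expR_ge0 _) dk.
  move=> z; rewrite gC gibbsE ler_pM2l ?invr_gt0 ?sqrt2pi_gt0// ler_expR.
  by have := aP z; rewrite -/b; lra.
have -> : gibbs k y = C * gdens (y + a) by rewrite gC gibbsE subrr mulr0 addr0.
rewrite E in lo hi.
have /andP[p0 p1] := dcdf_itv (y + a) dg.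
have gw : 0 < gdens (y + a) by exact: gdens_gt0.
have [wx|/ltW xw] := leP (y + a) x.
- have [h _] := gdens_hazard wx; rewrite -(ler_pM2r p0); apply: le_trans h _.
  by rewrite [leRHS]mulrAC [leLHS]mulrC ler_pM2r.
- have [_ h] := gdens_hazard xw.
  have q0 : 0 < 1 - dcdf (@gdens R) (y + a) by lra.
  rewrite -(ler_pM2r q0); apply: le_trans h _.
  by rewrite [leRHS]mulrAC [leLHS]mulrC ler_pM2r.
Qed.

(** * The gain inequality on the line *)

Lemma cvg_gauss_tail (R : realType) : n%:R * @gdens R n%:R @[n --> \oo] --> 0.
Proof.
rewrite -(cvg_shiftS (fun n : nat => n%:R * @gdens R n%:R)).
pose C : R := 2 * (Num.sqrt (2 * pi))^-1.
apply: (@squeeze_cvgr _ _ _ _ (cst 0) (fun n => C * harmonic n)).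
- near=> n; apply/andP; split.
    by rewrite /= mulr_ge0// ltW ?gdens_gt0.
  rewrite /C /harmonic/= /gdens mulNr expRN.
  have n0 : 0 < n.+1%:R :> R by rewrite ltr0n.
  have c0 : 0 < (Num.sqrt (2 * pi))^-1 :> R by rewrite invr_gt0 sqrt2pi_gt0.
  rewrite mulrCA [leRHS]mulrAC [leRHS]mulrC ler_pM2l//.
  rewrite ler_pdivrMr ?expR_gt0// mulrAC ler_pdivlMr//.
  have := expR_ge1Dx (n.+1%:R ^+ 2 / 2 : R); nra.
- exact: cvg_cst.
- by rewrite -[X in _ --> X](mulr0 C); apply: cvgM; [exact: cvg_cst|exact: cvg_harmonic].
Unshelve. all: by end_near. Qed.

Lemma cvg_gauss_itv (R : realType) :
  (\int[lebesgue_measure]_(x in `[- n%:R, n%:R]) @gdens R x)%R @[n --> \oo] --> (1 : R).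
Proof.
have gE (n : nat) : (\int[lebesgue_measure]_(x in `[- n%:R, n%:R]) @gdens R x)%R
    = fine (gauss1 R `[- n%:R, n%:R]%classic) by rewrite gauss1E.
under eq_fun do rewrite gE.
apply: fine_cvg; rewrite -(probability_setT (gauss1 R)).
rewrite (_ : setT = \bigcup_n (fun n => `[- n%:R, n%:R]%classic) n).
  apply: nondecreasing_cvg_mu => //; first exact: bigcup_measurable.
  move=> n m nm; apply/subsetPset => x/=; rewrite !in_itv/= => /andP[a b].
  have : n%:R <= m%:R :> R by rewrite ler_nat.
  lra.
apply/esym; rewrite -subTset => t _/=.
exists (Num.truncn `|t|).+1; rewrite //= in_itv/= -ler_norml.
by rewrite ltW// truncnS_gt.
Qed.

(** Up to the sign, [(x * d x - m x) * gdens x] is the derivative of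
    [d x * gdens x], so it has mean zero and Jensen's inequality gives the claim.
    Jensen's inequality is used in the form of a tangent line of the exponential,
    integrated over the segment from [- n] to [n]: there the boundary term is controlled by
    [2 n * gdens n], because [d] is 1-Lipschitz, and the exponent need not be
    integrable on the whole line. *)
Lemma gauss_jensen (R : realType) (c B : R) (f d m : R -> R) : 0 <= c <= 1 ->
  measurable_fun setT f -> (forall x, 0 <= f x <= B) ->
  (forall x : R, is_derive x 1 d (m x)) -> continuous m ->
  (forall x, 0 <= m x <= 1) ->
  ((expR (- fine (\int[gauss1 R]_x (f x)%:E)))%:E <=
   \int[lebesgue_measure]_x
     (expR (- f x + c * (x * d x - m x)) * gdens x)%:E)%E.
Proof.
move=> /andP[c0 c1] mf fB dd cm m01.
have f0 x : 0 <= f x by case/andP: (fB x).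
have g0 (z : R) : 0 <= gdens z by rewrite ltW ?gdens_gt0.
have mg := @measurable_gdens R.
have cd : continuous d by move=> x; exact: is_derive1_continuous (dd x).
set J := fine _.
pose p (x : R) := (x * d x - m x) * gdens x.
have cp : continuous p.
  move=> x; apply: cvgM; last exact: continuous_gdens.
  by apply: cvgB; [apply: cvgM; [exact: cvg_id|exact: cd]|exact: cm].
pose g x := expR (- f x + c * (x * d x - m x)) * gdens x.
have mgg : measurable_fun setT g.
  apply: measurable_funM => //; apply: measurableT_comp => //.
  apply: measurable_funD; first exact: measurableT_comp.
  apply: measurable_funM => //; apply: measurable_funB.
    by apply: measurable_funM => //; exact: continuous_measurable_fun.
  exact: continuous_measurable_fun.
have gg0 x : 0 <= g x by rewrite mulr_ge0 ?expR_ge0.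
have [|gfin] := eqVneq (\int[lebesgue_measure]_x (g x)%:E)%E +oo%E.
  by move=> ->; rewrite leey.
have ig : (@lebesgue_measure R).-integrable setT (EFin \o g).
  apply/integrableP; split; first exact/measurable_EFinP.
  under eq_integral do rewrite /= ger0_norm//.
  by rewrite ltey.
have ifg : (@lebesgue_measure R).-integrable setT (EFin \o (fun x : R => f x * gdens x)).
  have := integrableZl measurableT B (@integrable_gdens R).
  apply: le_integrable => //.
    by apply/measurable_EFinP; exact: measurable_funM.
  move=> x _ /=; rewrite lee_fin !ger0_norm ?mulr_ge0//.
    by rewrite ler_wpM2r//; case/andP: (fB x).
  by rewrite (le_trans (f0 x))//; case/andP: (fB x).
have JE : J = (\int[lebesgue_measure]_x (f x * gdens x))%R.
  rewrite /J integral_gauss1//; exact/measurable_EFinP.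
have key (n : nat) : expR (- J) * ((1 + J) *
    (\int[lebesgue_measure]_(x in `[- n%:R, n%:R]) @gdens R x)%R - J
    - 2 * (n%:R * gdens n%:R)) <= (\int[lebesgue_measure]_x g x)%R.
  pose A : R := n%:R; have A0 : 0 <= A by rewrite /A ler0n.
  rewrite -/A; pose I := `[- A, A]%classic : set R.
  have mI : measurable (I : set (measurableTypeR R)) by exact: measurable_itv.
  have ip : (@lebesgue_measure R).-integrable I (EFin \o p).
    apply: continuous_compact_integrable; first exact: segment_compact.
    exact: continuous_subspaceT.
  have igd : (@lebesgue_measure R).-integrable I (EFin \o @gdens R).
    by apply: integrableS (@integrable_gdens R).
  have ifI : (@lebesgue_measure R).-integrable I (EFin \o (fun x : R => f x * gdens x)).
    by apply: integrableS ifg.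
  have pI : - (2 * (A * gdens A)) <= (\int[lebesgue_measure]_(x in I) p x)%R.
    move: A0; rewrite le_eqVlt => /predU1P[A0|A0].
      rewrite /I -A0 oppr0 set_itv1 Rintegral_set1.
      by rewrite mul0r mulr0 oppr0.
    pose F (x : R) := - (d x * gdens x).
    have dF (x : R) : is_derive x 1 F (p x).
      have := dd x; have := is_derive_gdens x => h1 h2.
      by apply: is_derive_eq; rewrite /GRing.scale/= /p; ring.
    have cF : continuous F by move=> x; exact: is_derive1_continuous (dF x).
    have AA : - A < A by lra.
    rewrite /Rintegral (@continuous_FTC2 _ p F)//; last 3 first.
    - exact: continuous_subspaceT.
    - split.
      + by move=> x _; case: (dF x).
      + by apply: cvg_at_right_filter; exact: cF.
      + by apply: cvg_at_left_filter; exact: cF.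
    - by move=> x _; rewrite derive1E; case: (dF x).
    rewrite /= /F gdensN.
    have cont : {within `[- A, A], continuous d} by exact: continuous_subspaceT.
    have [z _ E] := MVT AA (fun z _ => dd z) cont.
    have /andP[_ mz1] := m01 z.
    have : d A - d (- A) <= 2 * A by rewrite E; nra.
    by have := g0 A; nra.
  have i1 : (@lebesgue_measure R).-integrable I
      (EFin \o (fun x : R => (1 + J) * gdens x)) by exact (integrableZl mI (1 + J) igd).
  have i2 : (@lebesgue_measure R).-integrable I
      (EFin \o (fun x : R => (1 + J) * gdens x - f x * gdens x)).
    exact (integrableB mI i1 ifI).
  have i3 : (@lebesgue_measure R).-integrable I (EFin \o (fun x : R => c * p x)).
    exact (integrableZl mI c ip).
  have i4 : (@lebesgue_measure R).-integrable I
      (EFin \o (fun x : R => (1 + J) * gdens x - f x * gdens x + c * p x)).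
    exact (integrableD mI i2 i3).
  apply: (@le_trans _ _ (\int[lebesgue_measure]_(x in I) g x)%R); last first.
    rewrite /Rintegral fine_le//.
    - by apply: integrable_fin_num => //; apply: integrableS ig.
    - by apply: integrable_fin_num.
    - apply: ge0_subset_integral => //; first exact/measurable_EFinP.
      by move=> x _; rewrite lee_fin.
  apply: (@le_trans _ _ (\int[lebesgue_measure]_(x in I)
    (expR (- J) * (((1 + J) * gdens x - f x * gdens x) + c * p x)))%R).
    rewrite RintegralZl// RintegralD// RintegralB//.
    rewrite (RintegralZl (1 + J) mI igd) (RintegralZl c mI ip).
    apply: ler_wpM2l; first exact: expR_ge0.
    have : (\int[lebesgue_measure]_(x in I) (f x * gdens x))%R <= J.
      rewrite JE /Rintegral fine_le//.
      - by apply: integrable_fin_num.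
      - by apply: integrable_fin_num.
      - apply: ge0_subset_integral => //.
          by apply/measurable_EFinP; exact: measurable_funM.
        by move=> x _; rewrite lee_fin mulr_ge0.
    have : 0 <= A * gdens A by rewrite mulr_ge0.
    rewrite -/I; nra.
  apply: le_Rintegral => //.
  - exact (integrableZl mI (expR (- J)) i4).
  - by apply: integrableS ig.
  - move=> x _; rewrite /g.
    have := expR_ge_tangent (- f x + c * (x * d x - m x)) (- J).
    move=> /(ler_wpM2r (g0 x)); apply: le_trans.
    by rewrite le_eqVlt; apply/orP; left; apply/eqP; rewrite /p; ring.
rewrite -(@fineK _ (\int[lebesgue_measure]_x _)%E); last first.
  by apply: integrable_fin_num.
rewrite lee_fin.
have lim : expR (- J) * ((1 + J) *
    (\int[lebesgue_measure]_(x in `[- n%:R, n%:R]) @gdens R x)%R - J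
    - 2 * (n%:R * gdens n%:R)) @[n --> \oo] --> expR (- J) * ((1 + J) * 1 - J - 2 * 0).
  apply: cvgM; first exact: cvg_cst.
  apply: cvgB; last by apply: cvgM; [exact: cvg_cst|exact: cvg_gauss_tail].
  apply: cvgB; last exact: cvg_cst.
  by apply: cvgM; [exact: cvg_cst|exact: cvg_gauss_itv].
rewrite (_ : expR (- J) = expR (- J) * ((1 + J) * 1 - J - 2 * 0)); last by ring.
by apply: (cvgr_to_le lim); apply: nearW.
Qed.

Lemma free_energy_cst0 d (T : measurableType d) (R : realType)
    (mu : probability T R) : free_energy mu (cst 0) = 0.
Proof.
rewrite /free_energy /laplace; under eq_integral do rewrite /= oppr0 expR0.
rewrite integral_cst// mul1e.
transitivity (- ln (fine (1%E : \bar R))); last by rewrite /= ln1 oppr0.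
by congr (- ln (fine _)); exact: probability_setT.
Qed.

Lemma gibbs_cst0 (R : realType) : gibbs (cst 0) = @gdens R.
Proof.
by apply/funext => x; rewrite /gibbs free_energy_cst0 subr0 expR0 mul1r.
Qed.

(** Let [T] be the monotone map from the Gaussian to [gibbs k], and substitute
    [S x = (1 - e) x + e T x = x - e d x] in the integral of [expR (- h)], where
    [d x = x - T x].  The derivative of [S] is bounded below by
    expR_interpolation; the exponents [t x] then cancel, because [T] transports
    to [gibbs k], and the quadratic terms combine into [(e - e ^+ 2) * x * d x].
    This and the correction of expR_interpolation form the divergence that
    gauss_jensen removes. *)
Lemma gaussian_gain1 (R : realType) (e B : R) (f h k : R -> R) : 0 < e < 1 ->
  measurable_fun setT f -> (forall x, 0 <= f x <= B) ->
  convex1 k -> (forall x, 0 <= k x) ->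
  measurable_fun setT h -> (forall x, 0 <= h x) ->
  (forall x y : R, h ((1 - e) * x + e * y) <= f x + e ^+ 2 * k y) ->
  free_energy (gauss1 R) h <=
    fine (\int[gauss1 R]_x (f x)%:E) + e ^+ 2 * free_energy (gauss1 R) k.
Proof.
move=> /andP[e0 e1] mf fB ck k0 mh h0 hfk.
have ck' := convex1_continuous ck.
have [T [t [dT ct]]] := gibbs_transport (@cst_continuous _ _ (0 : R))
  (fun _ => lexx 0) ck' k0.
rewrite gibbs_cst0 free_energy_cst0 => TE gE tE.
set b := free_energy (gauss1 R) k in tE *.
set J := fine _.
(* [T] is a contraction *)
have t0 x : t x <= 0.
  have h1 := convex1_contraction ck k0 (TE x).
  have gk0 : 0 < gibbs k (T x) by have [_ + _] := prob_density_gibbs ck' k0.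
  by rewrite -ler_expR expR0 -(ler_pM2l gk0) mulr1 -gE.
apply: free_energy_le => //.
rewrite integral_gauss1; last 2 first.
- by apply/measurable_EFinP; exact: measurable_expRN.
- by move=> x; rewrite lee_fin expR_ge0.
pose S (x : R) : R := (1 - e) * x + e * T x.
pose S' (x : R) : R := (1 - e) + e * expR (t x).
have dS (x : R) : is_derive x 1 S (S' x).
  by apply: is_derive_eq; rewrite /GRing.scale/= /S'; ring.
have cS : continuous S by move=> x; exact: is_derive1_continuous (dS x).
have cS' : continuous S'.
  by move=> x; apply: cvgD; [exact: cvg_cst|apply: cvgM; [exact: cvg_cst|exact: ct]].
have S'l x : 1 - e <= S' x by rewrite lerDl mulr_ge0 ?expR_ge0// ltW.
have e1' : 0 < 1 - e by lra.
rewrite (change_of_variables e1' dS cS' S'l); last 2 first.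
- apply/measurable_EFinP/measurable_funM; last exact: measurable_gdens.
  exact: measurable_expRN.
- by move=> x; rewrite lee_fin mulr_ge0 ?expR_ge0// ltW ?gdens_gt0.
pose d (x : R) : R := x - T x.
pose m (x : R) : R := 1 - expR (t x).
have dd (x : R) : is_derive x 1 d (m x) by apply: is_derive_eq.
have cm : continuous m by move=> x; apply: cvgB; [exact: cvg_cst|exact: ct].
have m01 x : 0 <= m x <= 1.
  have := t0 x; rewrite -ler_expR expR0 => h1; have h2 := expR_ge0 (t x).
  by rewrite /m; lra.
have c01 : 0 <= e - e ^+ 2 <= 1 by nra.
have := gauss_jensen c01 mf fB dd cm m01; rewrite -/J => jensen.
have g0 (z : R) : 0 <= gdens z by rewrite ltW ?gdens_gt0.
have cd : continuous d by move=> x; exact: is_derive1_continuous (dd x).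
pose q x := expR (- f x + (e - e ^+ 2) * (x * d x - m x)) * gdens x.
have mq : measurable_fun setT q.
  apply: measurable_funM; last exact: measurable_gdens.
  apply: measurableT_comp => //.
  apply: measurable_funD; first exact: measurableT_comp.
  apply: measurable_funM => //; apply: measurable_funB.
    by apply: measurable_funM => //; exact: continuous_measurable_fun.
  exact: continuous_measurable_fun.
have q0 x : 0 <= q x by rewrite mulr_ge0 ?expR_ge0.
apply: (@le_trans _ _ ((expR (- (e ^+ 2 * b)))%:E *
    \int[lebesgue_measure]_x (q x)%:E)%E).
  rewrite opprD expRD EFinM muleC; by apply: lee_wpmul2l; rewrite ?lee_fin ?expR_ge0.
rewrite -ge0_integralZl ?lee_fin ?expR_ge0//; last 2 first.
- by apply/measurable_EFinP; exact: mq.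
- by move=> x _; rewrite lee_fin.
apply: ge0_le_integral => //.
- by move=> x _; rewrite mule_ge0// lee_fin ?expR_ge0.
- by apply: measurable_funeM; apply/measurable_EFinP.
- apply/measurable_EFinP; apply: measurable_funM.
    apply: measurable_funM.
      apply: measurableT_comp => //; apply: measurableT_comp => //.
      apply: measurableT_comp => //.
      exact: continuous_measurable_fun.
    apply: measurableT_comp; first exact: measurable_gdens.
    exact: continuous_measurable_fun.
  exact: continuous_measurable_fun.
- move=> x _; rewrite -!EFinM lee_fin /q /gdens.
  have c0 : 0 < (Num.sqrt (2 * pi))^-1 :> R by rewrite invr_gt0 sqrt2pi_gt0.
  have e01 : 0 <= e <= 1 by lra.
  have le1 := expR_interpolation e01 (t0 x); rewrite -/(S' x) in le1.
  set s := e ^+ 2 * t x - _ in le1.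
  apply: (@le_trans _ _ (expR (- h (S x)) *
    ((Num.sqrt (2 * pi))^-1 * expR (- S x ^+ 2 / 2)) * expR s)); last first.
    by rewrite ler_wpM2l// mulr_ge0 ?expR_ge0// mulr_ge0 ?expR_ge0// ltW.
  rewrite [leLHS](_ : _ = (Num.sqrt (2 * pi))^-1 * expR (- (e ^+ 2 * b) +
    (- f x + (e - e ^+ 2) * (x * d x - m x)) + (- x ^+ 2 / 2))); last first.
    by rewrite [X in _ = _ * X]expRD [expR (- (e ^+ 2 * b) + _)]expRD; ring.
  rewrite [leRHS](_ : _ = (Num.sqrt (2 * pi))^-1 *
    expR (- h (S x) + (- S x ^+ 2 / 2) + s)); last first.
    by rewrite [X in _ = _ * X]expRD [expR (- h (S x) + _)]expRD; ring.
  rewrite ler_pM2l// ler_expR.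
  have := hfk x (T x); rewrite -/(S x) => hS.
  (* [tE] solved for [k (T x)]: the multiple of [t x] it brings is the one in [s] *)
  have kE : k (T x) = t x + b + x ^+ 2 / 2 - T x ^+ 2 / 2 by rewrite tE; ring.
  rewrite kE in hS.
  have -> : - (e ^+ 2 * b) + (- f x + (e - e ^+ 2) * (x * d x - m x)) + - x ^+ 2 / 2
     = - (f x + e ^+ 2 * (t x + b + x ^+ 2 / 2 - T x ^+ 2 / 2))
       + (- S x ^+ 2 / 2) + s.
    by rewrite /s /S /d /m; field.
  by rewrite !lerD2r lerN2.
Qed.

(** * The Gaussian law on tuples *)

Definition tcons (R : realType) n (x : R) (s : n.-tuple (measurableTypeR R)) :
  n.+1.-tuple (measurableTypeR R) := [tuple of x :: s].

Definition tmix (R : realType) n (l : R) (x y : n.-tuple (measurableTypeR R)) :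
    n.-tuple (measurableTypeR R) :=
  [tuple ((1 - l) * tnth x i + l * tnth y i : R) | i < n].

Definition convexT (R : realType) n (f : n.-tuple (measurableTypeR R) -> R) :=
  forall l x y, 0 < l < 1 -> f (tmix l x y) <= (1 - l) * f x + l * f y.

Definition box (R : realType) n (A : 'I_n -> set R) :
  set (n.-tuple (measurableTypeR R)) := [set s | forall i, A i (tnth s i)].

(** The law is characterized by the product rule on boxes, so that it applies to
    the law of a Gaussian vector without comparing measures first. *)
Definition gauss_law (R : realType) n
    (mu : probability (n.-tuple (measurableTypeR R)) R) : Prop :=
  forall A : 'I_n -> set (measurableTypeR R), (forall i, measurable (A i)) ->
    mu (box A) = (\prod_(i < n) gauss1 R (A i))%E.

Lemma tmix_cons (R : realType) n (l x y : R)
    (s t : n.-tuple (measurableTypeR R)) :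
  tmix l (tcons x s) (tcons y t) = tcons ((1 - l) * x + l * y) (tmix l s t).
Proof.
apply: eq_from_tnth => i; rewrite tnth_mktuple.
have [j ->|->] := unliftP ord0 i.
  by rewrite !tnthS tnth_mktuple.
by rewrite !tnth0.
Qed.

Lemma measurable_tcons (R : realType) n :
  measurable_fun setT (fun z : measurableTypeR R * n.-tuple (measurableTypeR R) =>
    tcons z.1 z.2).
Proof. exact: measurable_cons. Qed.

Lemma measurable_tcons2 (R : realType) n (x : R) :
  measurable_fun setT (@tcons R n x).
Proof. by apply: measurable_cons => //; exact: measurable_id. Qed.

Lemma measurable_box (R : realType) n (A : 'I_n -> set (measurableTypeR R)) :
  (forall i, measurable (A i)) -> measurable (box A).
Proof.
move=> mA; rewrite (_ : box A = \bigcap_(i in [set: 'I_n])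
    (fun s : n.-tuple (measurableTypeR R) => tnth s i) @^-1` (A i)).
  apply: fin_bigcap_measurable; first exact: finite_finset.
  by move=> i _; rewrite -[X in measurable X]setTI; apply: measurable_tnth.
by apply/seteqP; split => s /= sA i; [move=> _; exact: sA|exact: (sA i I)].
Qed.

(** Boxes are stable under intersection and generate the measurable sets of
    tuples. *)
Lemma eq_measure_box (R : realType) n
    (mu nu : {measure set (n.-tuple (measurableTypeR R)) -> \bar R}) :
  (mu setT < +oo)%E ->
  (forall A : 'I_n -> set (measurableTypeR R), (forall i, measurable (A i)) ->
    mu (box A) = nu (box A)) ->
  forall E, measurable E -> mu E = nu E.
Proof.
move=> muT munu E mE.
pose G := [set box A | A in [set A : 'I_n -> set (measurableTypeR R) |
  forall i, measurable (A i)]].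
have GT : G setT.
  exists (fun=> setT) => /=; first by move=> i; exact: measurableT.
  by apply/seteqP; split.
apply: (g_sigma_algebra_measure_unique G _ (fun=> setT)) => //.
- by move=> _ [A mA <-]; exact: measurable_box.
- by rewrite bigcup_const.
- move=> _ _ [A mA <-] [B mB <-]; exists (fun i => A i `&` B i) => /=.
    by move=> i; apply: measurableI.
  by apply/seteqP; split => s /= => [sAB|[sA sB] i]; [split => i; have [] := sAB i|].
- by move=> _ [A mA <-]; exact: munu.
- move: E mE; apply: smallest_sub; first exact: smallest_sigma_algebra.
  rewrite -bigcup_seq => B [i _ [A mA <-]]; apply: sub_sigma_algebra.
  exists (fun j => if j == i then A else setT) => /=.
    by move=> j; case: ifP => // _; exact: measurableT.
  apply/seteqP; split => s /=.
    by move=> /(_ i); rewrite eqxx.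
  by move=> [_ sA] j; case: eqP => // ->.
Qed.

(** The law of the tail is again Gaussian; on boxes, [mu] agrees with the image of
    the product of [gauss1 R] and that law, so Tonelli's theorem applies. *)
Lemma gauss_law_disintegration (R : realType) n
    (mu : probability (n.+1.-tuple (measurableTypeR R)) R) : gauss_law mu ->
  exists2 nu : probability (n.-tuple (measurableTypeR R)) R, gauss_law nu &
    forall F : n.+1.-tuple (measurableTypeR R) -> \bar R,
      measurable_fun setT F -> (forall s, (0 <= F s)%E) ->
      (\int[mu]_s F s = \int[gauss1 R]_x \int[nu]_s F (tcons x s))%E.
Proof.
move=> gmu.
pose tl := fun s : n.+1.-tuple (measurableTypeR R) => [tuple of behead s].
have mtl : measurable_fun setT tl by exact: measurable_behead.
pose X : {mfun n.+1.-tuple (measurableTypeR R) >-> n.-tuple (measurableTypeR R)} :=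
  HB.pack tl (isMeasurableFun.Build _ _ _ _ tl mtl).
pose nu : probability (n.-tuple (measurableTypeR R)) R := distribution mu X.
have gnu : gauss_law nu.
  move=> A mA; change (mu (X @^-1` box A) = \prod_(i < n) gauss1 R (A i))%E.
  pose B (i : 'I_n.+1) : set (measurableTypeR R) := oapp A setT (unlift ord0 i).
  have -> : X @^-1` box A = box B.
    apply/seteqP; split => s /= sA i.
      rewrite /B; case: unliftP => [j ->|->]//=.
      by have := sA j; rewrite /X/= /tl tnth_behead (_ : inord _ = lift ord0 j)//;
        apply/val_inj; rewrite /= inordK// ltnS.
    have := sA (lift ord0 i); rewrite /B liftK/=.
    rewrite /tl tnth_behead (_ : inord _ = lift ord0 i)//.
    by apply/val_inj; rewrite /= inordK// ltnS.
  rewrite gmu; last by move=> i; rewrite /B; case: unliftP => [j _|_]/=;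
    [exact: mA|exact: measurableT].
  rewrite big_ord_recl /B unlift_none /= probability_setT mul1e.
  by apply: eq_bigr => i _; rewrite liftK.
exists nu => // F mF F0.
pose cons' := fun z : measurableTypeR R * n.-tuple (measurableTypeR R) => tcons z.1 z.2.
have mc : measurable_fun setT cons' by exact: measurable_tcons.
transitivity (\int[pushforward (gauss1 R \x nu) cons']_s F s)%E.
  apply: eq_measure_integral => E mE _.
  apply: eq_measure_box mE => [|A mA].
    by rewrite (le_lt_trans (probability_le1 _ _)) ?ltry.
  apply: (eq_trans (gmu A mA)); rewrite big_ord_recl.
  change (gauss1 R (A ord0) * \prod_(i < n) gauss1 R (A (lift ord0 i)) =
    (gauss1 R \x nu) (cons' @^-1` box A))%E.
  rewrite (_ : cons' @^-1` box A = A ord0 `*` box (fun i => A (lift ord0 i))).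
    rewrite product_measure1E//; last by apply: measurable_box.
    by congr (_ * _)%E; apply/esym/gnu.
  apply/seteqP; split => -[x s] /=.
    move=> sA; split; first by have := sA ord0; rewrite tnth0.
    by move=> i /=; have := sA (lift ord0 i); rewrite tnthS.
  move=> [Ax sA] i; rewrite /cons'/=.
  by have [j ->|->] := unliftP ord0 i; [rewrite tnthS; exact: sA|rewrite tnth0].
rewrite ge0_integral_pushforward// preimage_setT.
have mFc : measurable_fun setT (F \o cons') by exact: (measurableT_comp mF mc).
by rewrite fubini_tonelli1// => z; exact: F0.
Qed.

(** * Tensorization of the two inequalities *)

Lemma measurable_integral_tcons (R : realType) n
    (nu : probability (n.-tuple (measurableTypeR R)) R)
    (F : n.+1.-tuple (measurableTypeR R) -> \bar R) :
  measurable_fun setT F -> (forall s, (0 <= F s)%E) ->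
  measurable_fun setT (fun x : measurableTypeR R => \int[nu]_s F (tcons x s))%E.
Proof.
move=> mF F0.
have mFc := measurableT_comp mF (@measurable_tcons R n).
exact: (@measurable_fun_fubini_tonelli_F _ _ _ _ R nu _ mFc (fun z => F0 _)).
Qed.

Lemma measurable_free_energy_tcons (R : realType) n
    (nu : probability (n.-tuple (measurableTypeR R)) R)
    (f : n.+1.-tuple (measurableTypeR R) -> R) :
  measurable_fun setT f -> (forall s, 0 <= f s) ->
  measurable_fun setT
    (fun x : measurableTypeR R => free_energy nu (fun s => f (tcons x s))).
Proof.
move=> mf f0; apply: measurableT_comp => //; apply: measurableT_comp.
  exact: measurable_ln.
apply: measurableT_comp; first exact: fine_measurable.
apply: (@measurable_integral_tcons R n nu (fun s => (expR (- f s))%:E)).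
  by apply/measurable_EFinP; exact: measurable_expRN.
by move=> s; rewrite lee_fin expR_ge0.
Qed.

Lemma free_energy_tcons (R : realType) n
    (mu : probability (n.+1.-tuple (measurableTypeR R)) R)
    (nu : probability (n.-tuple (measurableTypeR R)) R)
    (f : n.+1.-tuple (measurableTypeR R) -> R) :
  (forall F : n.+1.-tuple (measurableTypeR R) -> \bar R,
      measurable_fun setT F -> (forall s, (0 <= F s)%E) ->
      (\int[mu]_s F s = \int[gauss1 R]_x \int[nu]_s F (tcons x s))%E) ->
  measurable_fun setT f -> (forall s, 0 <= f s) ->
  free_energy mu f =
  free_energy (gauss1 R) (fun x => free_energy nu (fun s => f (tcons x s))).
Proof.
move=> dis mf f0; rewrite {1 2}/free_energy; congr (- ln (fine _)).
rewrite dis; last 2 first.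
- by apply/measurable_EFinP; exact: measurable_expRN.
- by move=> s; rewrite lee_fin expR_ge0.
apply: eq_integral => x _.
have mfx : measurable_fun setT (fun s => f (tcons x s)).
  exact: measurableT_comp (measurable_tcons2 x).
by rewrite laplace_free_energy// laplaceE.
Qed.

Lemma integral_tuple0 (R : realType)
    (mu : probability (0.-tuple (measurableTypeR R)) R)
    (f : 0.-tuple (measurableTypeR R) -> R) :
  (\int[mu]_x (f x)%:E = (f [tuple])%:E)%E.
Proof.
transitivity (\int[mu]_x (cst (f [tuple])%:E x))%E.
  by apply: eq_integral => x _; rewrite [x]tuple0.
by rewrite integral_cst// -[RHS]mule1; congr (_ * _)%E; exact: probability_setT.
Qed.

Lemma free_energy_tuple0 (R : realType)
    (mu : probability (0.-tuple (measurableTypeR R)) R)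
    (f : 0.-tuple (measurableTypeR R) -> R) : free_energy mu f = f [tuple].
Proof.
rewrite /free_energy /laplace (integral_tuple0 mu (fun s => expR (- f s))).
by rewrite /= expRK opprK.
Qed.

Lemma convexT_tcons (R : realType) n (f : n.+1.-tuple (measurableTypeR R) -> R)
    (x : R) : convexT f -> convexT (fun s => f (tcons x s)).
Proof.
move=> cf l s t l01; have := cf l (tcons x s) (tcons x t) l01.
by rewrite tmix_cons (_ : (1 - l) * x + l * x = x)//; ring.
Qed.

(** Induction on the dimension: for fixed first coordinates [x] and [y] the
    induction hypothesis bounds the free energy of the section of [h] at
    [(1 - l) x + l y], which is the hypothesis of prekopa_leindler1.  The induction
    hypothesis applied to a single function shows that the free energies of its
    sections are convex, hence continuous. *)
Lemma prekopa_leindler (R : realType) n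
    (mu : probability (n.-tuple (measurableTypeR R)) R) (l : R)
    (f g h : n.-tuple (measurableTypeR R) -> R) : gauss_law mu -> 0 < l < 1 ->
  measurable_fun setT f -> (forall x, 0 <= f x) -> convexT f ->
  measurable_fun setT g -> (forall x, 0 <= g x) -> convexT g ->
  measurable_fun setT h -> (forall x, 0 <= h x) ->
  (forall x y, h (tmix l x y) <= (1 - l) * f x + l * g y) ->
  free_energy mu h <= (1 - l) * free_energy mu f + l * free_energy mu g.
Proof.
elim: n => [|n IH] in mu l f g h *.
  move=> _ _ _ _ _ _ _ _ _ _ /(_ [tuple] [tuple]); rewrite !free_energy_tuple0.
  by rewrite [tmix _ _ _]tuple0.
move=> gmu l01 mf f0 cf mg g0 cg mh h0 hfg.
have [nu gnu dis] := gauss_law_disintegration gmu.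
have sm (q : n.+1.-tuple (measurableTypeR R) -> R) (x : R) :
    measurable_fun setT q -> measurable_fun setT (fun s => q (tcons x s)).
  by move=> mq; exact: measurableT_comp (measurable_tcons2 x).
have ge0 (q : n.+1.-tuple (measurableTypeR R) -> R) (x : R) :
    measurable_fun setT q -> (forall s, 0 <= q s) ->
    0 <= free_energy nu (fun s => q (tcons x s)).
  by move=> mq q0; apply: free_energy_ge0 => //; exact: sm.
have conv (q : n.+1.-tuple (measurableTypeR R) -> R) :
    measurable_fun setT q -> (forall s, 0 <= q s) -> convexT q ->
    convex1 (fun x => free_energy nu (fun s => q (tcons x s))).
  move=> mq q0 cq l' x y l'01; apply: IH => //; try exact: sm.
  - exact: convexT_tcons.
  - exact: convexT_tcons.
  - by move=> s t; rewrite -tmix_cons; exact: cq.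
rewrite !(free_energy_tcons dis)//.
apply: prekopa_leindler1 => //.
- by apply: convex1_continuous; exact: conv.
- by move=> x; exact: ge0.
- by apply: convex1_continuous; exact: conv.
- by move=> x; exact: ge0.
- exact: measurable_free_energy_tcons.
- by move=> x; exact: ge0.
- move=> x y; apply: IH => //; try exact: sm.
  + exact: convexT_tcons.
  + exact: convexT_tcons.
  + by move=> s t; rewrite -tmix_cons; exact: hfg.
Qed.

(** Same induction.  The sections of [k] contribute their free energies, which are
    convex by prekopa_leindler, and those of [f] contribute their means. *)
Lemma gaussian_gain (R : realType) n
    (mu : probability (n.-tuple (measurableTypeR R)) R) (e B : R)
    (f h k : n.-tuple (measurableTypeR R) -> R) : gauss_law mu -> 0 < e < 1 ->
  measurable_fun setT f -> (forall x, 0 <= f x <= B) ->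
  measurable_fun setT k -> (forall x, 0 <= k x) -> convexT k ->
  measurable_fun setT h -> (forall x, 0 <= h x) ->
  (forall x y, h (tmix e x y) <= f x + e ^+ 2 * k y) ->
  free_energy mu h <= fine (\int[mu]_x (f x)%:E) + e ^+ 2 * free_energy mu k.
Proof.
elim: n => [|n IH] in mu f h k *.
  move=> _ _ _ _ _ _ _ _ _ /(_ [tuple] [tuple]).
  by rewrite !free_energy_tuple0 integral_tuple0 [tmix _ _ _]tuple0.
move=> gmu e01 mf fB mk k0 ck mh h0 hfk.
have f0 s : 0 <= f s by case/andP: (fB s).
have [nu gnu dis] := gauss_law_disintegration gmu.
have sm (q : n.+1.-tuple (measurableTypeR R) -> R) (x : R) :
    measurable_fun setT q -> measurable_fun setT (fun s => q (tcons x s)).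
  by move=> mq; exact: measurableT_comp (measurable_tcons2 x).
have ge0 (q : n.+1.-tuple (measurableTypeR R) -> R) (x : R) :
    measurable_fun setT q -> (forall s, 0 <= q s) ->
    0 <= free_energy nu (fun s => q (tcons x s)).
  by move=> mq q0; apply: free_energy_ge0 => //; exact: sm.
have fxB x : (0 <= \int[nu]_s (f (tcons x s))%:E <= B%:E)%E.
  apply/andP; split; first by apply: integral_ge0 => s _; rewrite lee_fin.
  rewrite (_ : B%:E = \int[nu]_s B%:E)%E; last first.
    rewrite integral_cst// -[LHS]mule1; congr (_ * _)%E.
    by apply/esym; exact: probability_setT.
  apply: ge0_le_integral => //.
  - by move=> s _; rewrite lee_fin.
  - by apply/measurable_EFinP; exact: sm.
  - by move=> s _; rewrite lee_fin; case/andP: (fB (tcons x s)).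
pose F x := fine (\int[nu]_s (f (tcons x s))%:E).
have FE x : (F x)%:E = (\int[nu]_s (f (tcons x s))%:E)%E.
  have /andP[a b] := fxB x.
  by rewrite fineK// ge0_fin_numE// (le_lt_trans b) ?ltry.
rewrite !(free_energy_tcons dis)// dis; last 2 first.
- exact/measurable_EFinP.
- by move=> s; rewrite lee_fin.
under eq_integral do rewrite -FE.
apply: (@gaussian_gain1 R e B F) => //.
- apply: measurableT_comp; first exact: fine_measurable.
  apply: (@measurable_integral_tcons R n nu (fun s => (f s)%:E)).
    exact/measurable_EFinP.
  by move=> s; rewrite lee_fin.
- by move=> x; rewrite -!lee_fin FE fxB.
- move=> l x y l01; apply: prekopa_leindler => //; try exact: sm.
  + exact: convexT_tcons.
  + exact: convexT_tcons.
  + by move=> s t; rewrite -tmix_cons; exact: ck.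
- by move=> x; exact: ge0.
- exact: measurable_free_energy_tcons.
- by move=> x; exact: ge0.
- move=> x y; apply: IH => //; try exact: sm.
  + exact: convexT_tcons.
  + by move=> s t; rewrite -tmix_cons; exact: hfk.
Qed.

(** * Lower bounds for the mean excess over a median *)

(** Used with a superlevel set at a median and an [f] that is large there: the
    free energy of [f] is then bounded below. *)
Lemma laplace_le_half d (T : measurableType d) (R : realType)
    (mu : probability T R) (f : T -> R) (A : set T) (w : R) :
  measurable_fun setT f -> (forall x, 0 <= f x) -> measurable A ->
  ((2^-1)%:E <= mu A)%E -> 0 <= w -> (forall x, A x -> w <= f x) ->
  laplace mu f <= 2^-1 + 2^-1 * expR (- w).
Proof.
move=> mf f0 mA muA w0 fw.
have ew : expR (- w) <= 1 by rewrite -expR0 ler_expR oppr_le0.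
have mI : measurable_fun setT (fun x => (1 - expR (- w)) * \1_A x : R).
  by apply: measurable_funM => //; exact: measurable_indic.
have I0 x : 0 <= (1 - expR (- w)) * \1_A x :> R by rewrite mulr_ge0// subr_ge0.
have : (\int[mu]_x (expR (- f x) + (1 - expR (- w)) * \1_A x)%:E <= 1)%E.
  have -> : (1%E = \int[mu]_x (cst 1%E x))%E.
    by rewrite integral_cst// mul1e; apply/esym; exact: probability_setT.
  apply: ge0_le_integral => //.
  - by move=> x _; rewrite lee_fin addr_ge0 ?expR_ge0.
  - by apply/measurable_EFinP/measurable_funD => //; exact: measurable_expRN.
  - move=> x _; rewrite lee_fin indicE.
    have [|_] := boolP (x \in A).
      rewrite inE => /fw wf; rewrite mulr1.
      have : expR (- f x) <= expR (- w) by rewrite ler_expR lerN2.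
      lra.
    by rewrite mulr0 addr0 -expR0 ler_expR oppr_le0.
under eq_integral do rewrite EFinD.
rewrite ge0_integralD//; last 3 first.
- by apply/measurable_EFinP; exact: measurable_expRN.
- by move=> x _; rewrite lee_fin.
- exact/measurable_EFinP.
rewrite -laplaceE//.
under eq_integral do rewrite EFinM.
rewrite ge0_integralZl ?lee_fin ?subr_ge0//; last first.
  by apply/measurable_EFinP; exact: measurable_indic.
rewrite integral_indic// setIT => h.
have fA : mu A \is a fin_num by exact: fin_num_measure.
have h1 : ((laplace mu f)%:E + (1 - expR (- w))%:E * (fine (mu A))%:E <= 1)%E.
  by rewrite (fineK fA).
have h2 : ((2^-1)%:E <= (fine (mu A))%:E)%E by rewrite fineK.
by move: h1 h2; rewrite -EFinM -EFinD !lee_fin; nra.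
Qed.

(** The converse direction: the free energy of [f] is bounded above by minus the
    logarithm of the measure of a set on which [f] vanishes. *)
Lemma laplace_ge_measure d (T : measurableType d) (R : realType)
    (mu : probability T R) (f : T -> R) (A : set T) :
  measurable_fun setT f -> (forall x, 0 <= f x) -> measurable A ->
  (forall x, A x -> f x = 0) -> (mu A <= (laplace mu f)%:E)%E.
Proof.
move=> mf f0 mA fA; rewrite laplaceE// -[X in mu X]setIT -integral_indic//.
apply: ge0_le_integral => //.
- by apply/measurable_EFinP; exact: measurable_indic.
- by apply/measurable_EFinP; exact: measurable_expRN.
- move=> x _; rewrite lee_fin indicE; have [|_] := boolP (x \in A).
    by rewrite inE => /fA ->; rewrite oppr0 expR0.
  exact: expR_ge0.
Qed.

Lemma measurable_sublevel d (T : measurableType d) (R : realType)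
    (F : T -> R) (a : R) : measurable_fun setT F ->
  measurable [set x | F x <= a].
Proof.
move=> mF; rewrite (_ : [set x | F x <= a] = F @^-1` `]-oo, a]).
  by rewrite -[X in measurable X]setTI; apply: mF.
by apply/seteqP; split => x; rewrite /= in_itv.
Qed.

Lemma measurable_superlevel d (T : measurableType d) (R : realType)
    (F : T -> R) (a : R) : measurable_fun setT F ->
  measurable [set x | a <= F x].
Proof.
move=> mF; rewrite (_ : [set x | a <= F x] = F @^-1` `[a, +oo[).
  by rewrite -[X in measurable X]setTI; apply: mF.
by apply/seteqP; split => x; rewrite /= in_itv/= andbT.
Qed.

Definition excess (R : realType) (N a : R) (y : R) : R := N * Num.max (y - a) 0.

Lemma excess_ge0 (R : realType) (N a y : R) : 0 <= N -> 0 <= excess N a y.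
Proof. by move=> N0; rewrite mulr_ge0// le_max lexx orbT. Qed.

Lemma excess_eq0 (R : realType) (N a y : R) : y <= a -> excess N a y = 0.
Proof. by move=> ya; rewrite /excess max_r ?mulr0// subr_le0. Qed.

Lemma excess_homo (R : realType) (N a y z : R) : 0 <= N -> y <= z ->
  excess N a y <= excess N a z.
Proof.
by move=> N0 yz; rewrite ler_wpM2l// ge_max !le_max lexx orbT lerB.
Qed.

(** Mixing levels and values with the same weights: this turns convexity of [F]
    into the hypotheses of the two free energy inequalities. *)
Lemma excess_mix (R : realType) (l N a b y z : R) : 0 <= l <= 1 -> 0 <= N ->
  excess N ((1 - l) * a + l * b) ((1 - l) * y + l * z)
    <= (1 - l) * excess N a y + l * excess N b z.
Proof.
move=> /andP[l0 l1] N0; rewrite /excess.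
rewrite [leRHS](_ : _ = N * ((1 - l) * Num.max (y - a) 0 + l * Num.max (z - b) 0)); last ring.
have l1' : 0 <= 1 - l by lra.
have h1 : y - a <= Num.max (y - a) 0 by rewrite le_max lexx.
have h2 : z - b <= Num.max (z - b) 0 by rewrite le_max lexx.
have h3 : 0 <= Num.max (y - a) 0 by rewrite le_max lexx orbT.
have h4 : 0 <= Num.max (z - b) 0 by rewrite le_max lexx orbT.
rewrite ler_wpM2l// ge_max; apply/andP; split; nra.
Qed.

Lemma measurable_excess d (T : measurableType d) (R : realType) (F : T -> R)
    (N a : R) : measurable_fun setT F ->
  measurable_fun setT (fun x => excess N a (F x)).
Proof.
move=> mF; apply: measurable_funM => //; apply: measurable_maxr => //.
exact: measurable_funB.
Qed.

Lemma convexT_excess (R : realType) n (F : n.-tuple (measurableTypeR R) -> R)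
    (N a : R) : 0 <= N -> convexT F -> convexT (fun x => excess N a (F x)).
Proof.
move=> N0 cF l x y l01; apply: le_trans (excess_homo a N0 (cF l x y l01)) _.
have l01' : 0 <= l <= 1 by lra.
have := excess_mix a a (F x) (F y) l01' N0.
by rewrite (_ : (1 - l) * a + l * a = a)//; ring.
Qed.

(** As [N] tends to infinity, the free energy of [N (F - a)_+] tends to minus the
    logarithm of the probability that [F <= a].  At the mixed level, which is
    below [M], this probability is at most one half. *)
Lemma sublevel_log_concave (R : realType) n
    (mu : probability (n.-tuple (measurableTypeR R)) R)
    (F : n.-tuple (measurableTypeR R) -> R) (M a b l pa pb : R) :
  gauss_law mu -> measurable_fun setT F -> convexT F ->
  ((2^-1)%:E <= mu [set x | (M <= F x)%R])%E ->
  0 < l < 1 -> (1 - l) * a + l * b < M ->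
  0 < pa -> (pa%:E <= mu [set x | (F x <= a)%R])%E ->
  0 < pb -> (pb%:E <= mu [set x | (F x <= b)%R])%E ->
  (1 - l) * ln pa + l * ln pb <= - ln 2.
Proof.
move=> gmu mF cF hM l01 cM pa0 hpa pb0 hpb.
have l01' : 0 <= l <= 1 by lra.
set c := (1 - l) * a + l * b in cM.
set L := (1 - l) * ln pa + l * ln pb.
have feb q (N r : R) : 0 <= N -> 0 < q ->
    (q%:E <= mu [set x | (F x <= r)%R])%E ->
    free_energy mu (fun x => excess N r (F x)) <= - ln q.
  move=> N0 q0 hq; rewrite lerN2 ler_ln ?posrE//; last first.
    apply: laplace_gt0; first exact: measurable_excess.
    by move=> x; exact: excess_ge0.
  rewrite -lee_fin; apply: le_trans hq _; apply: laplace_ge_measure.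
  - exact: measurable_excess.
  - by move=> x; exact: excess_ge0.
  - exact: measurable_sublevel.
  - by move=> x /= Fx; exact: excess_eq0.
have key N : 0 <= N -> expR L <= 2^-1 + 2^-1 * expR (- (N * (M - c))).
  move=> N0.
  have mE r := measurable_excess N r mF.
  have E0 r x : 0 <= excess N r (F x) by exact: excess_ge0.
  have PL : free_energy mu (fun x => excess N c (F x)) <=
      (1 - l) * free_energy mu (fun x => excess N a (F x)) +
      l * free_energy mu (fun x => excess N b (F x)).
    apply: prekopa_leindler => //; try exact: convexT_excess.
    move=> x y; apply: le_trans (excess_mix a b (F x) (F y) l01' N0).
    by apply: excess_homo => //; exact: cF.
  have lap : laplace mu (fun x => excess N c (F x)) <=
      2^-1 + 2^-1 * expR (- (N * (M - c))).
    apply: (laplace_le_half _ _ _ hM) => //.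
    - exact: measurable_superlevel.
    - by rewrite mulr_ge0// subr_ge0 ltW.
    - by move=> x /= MF; rewrite ler_wpM2l// le_max lerB.
  apply: le_trans lap; rewrite -laplace_free_energy// ler_expR.
  have h1 := feb pa N a N0 pa0 hpa; have h2 := feb pb N b N0 pb0 hpb.
  rewrite /L; move: PL h1 h2.
  move: (free_energy _ _) (free_energy _ _) (free_energy _ _) (ln pa) (ln pb).
  move=> A B C lpa lpb PL h1 h2; have /andP[l0 l1] := l01.
  have h1' : (1 - l) * B <= (1 - l) * - lpa by rewrite ler_wpM2l// subr_ge0 ltW.
  have h2' : l * A <= l * - lpb by rewrite ler_wpM2l// ltW.
  by move: PL h1' h2'; clear; lra.
have Mc : 0 < M - c by lra.
suff : expR L <= 2^-1.
  by rewrite -[2^-1]lnK ?posrE// ler_expR lnV// posrE.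
have lim : (2^-1 + 2^-1 * expR (- n%:R) : R) @[n --> \oo] --> (2^-1 + 2^-1 * 0 : R).
  apply: cvgD; first exact: cvg_cst.
  by apply: cvgM; [exact: cvg_cst|exact: cvgn_expR].
rewrite mulr0 addr0 in lim.
apply: (cvgr_to_ge lim); apply: nearW => m.
have := key (m%:R / (M - c)); rewrite divfK ?gt_eqF//; apply.
by rewrite divr_ge0 ?ler0n// ltW.
Qed.

(** Markov's inequality for [(F - M)_+]. *)
Lemma excess_tail_bound d (T : measurableType d) (R : realType)
    (mu : probability T R) (F : T -> R) (M u E : R) :
  measurable_fun setT F -> 0 < u ->
  (\int[mu]_x (Num.max (F x - M) 0)%:E = E%:E)%E ->
  u * (1 - fine (mu [set x | (F x <= M + u)%R])) <= E.
Proof.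
move=> mF u0 hE; set A := [set x | _].
have mA : measurable A by exact: measurable_sublevel.
have fA : mu A \is a fin_num by exact: fin_num_measure.
have mI : measurable_fun setT (fun x => u * \1_(~` A) x : R).
  by apply: measurable_funM => //; apply: measurable_indic; exact: measurableC.
have : (u%:E * mu (~` A) <= E%:E)%E.
  rewrite -[X in mu X]setIT -integral_indic//; last exact: measurableC.
  rewrite -ge0_integralZl ?lee_fin ?(ltW u0)//; last first.
    by apply/measurable_EFinP; apply: measurable_indic; exact: measurableC.
  rewrite -hE; apply: ge0_le_integral => //.
  - by move=> x _; rewrite -EFinM lee_fin mulr_ge0// ltW.
  - exact/measurable_EFinP.
  - by apply/measurable_EFinP; apply: measurable_maxr => //; exact: measurable_funB.
  - move=> x _; rewrite -EFinM lee_fin indicE.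
    have [|_] := boolP (x \in ~` A); last by rewrite mulr0 le_max lexx orbT.
    rewrite inE /A/= => /negP; rewrite -ltNge => h.
    by rewrite mulr1 le_max lerBrDl ltW.
rewrite probability_setC//.
have h1 : (u%:E * (1 - (fine (mu A))%:E) <= E%:E)%E ->
  u * (1 - fine (mu A)) <= E by rewrite -EFinB -EFinM lee_fin.
by move=> h; apply: h1; rewrite (fineK fA).
Qed.

(** [rho] is the ratio of the weights given to the levels [M - s] and [M + u].
    As [u < rho * s] the mixed level is below [M], and log-concavity bounds the
    probability that [F <= M + u] by [expR (rho * D) / 2]. *)
Lemma excess_lower_bound_log_concave (R : realType) n
    (mu : probability (n.-tuple (measurableTypeR R)) R)
    (F : n.-tuple (measurableTypeR R) -> R) (M s E D rho u : R) :
  gauss_law mu -> measurable_fun setT F -> convexT F ->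
  ((2^-1)%:E <= mu [set x | (M <= F x)%R])%E ->
  (\int[mu]_x (Num.max (F x - M) 0)%:E = E%:E)%E ->
  0 < s -> ((2^-1 * expR (- D))%:E <= mu [set x | (F x <= M - s)%R])%E ->
  0 < u -> 0 < rho -> u < rho * s ->
  u * (1 - 2^-1 * expR (rho * D)) <= E.
Proof.
move=> gmu mF cF hM hE s0 hD u0 rho0 us.
apply: le_trans (excess_tail_bound mF u0 hE); rewrite ler_pM2l// lerB//.
set A := [set x | _].
have mA : measurable A by exact: measurable_sublevel.
have fA : mu A \is a fin_num by exact: fin_num_measure.
have [p0|p0] := leP (fine (mu A)) 0.
  by apply: le_trans p0 _; rewrite mulr_ge0// expR_ge0.
have r1 : 0 < 1 + rho by lra.
pose l := rho / (1 + rho).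
have l0 : 0 < l by rewrite divr_gt0.
have l1E : 1 - l = (1 + rho)^-1 by rewrite /l; field; rewrite gt_eqF.
have l1 : 0 < 1 - l by rewrite l1E invr_gt0.
have l01 : 0 < l < 1 by lra.
have cM : (1 - l) * (M + u) + l * (M - s) < M.
  have : (1 - l) * (u - rho * s) < 0 by rewrite pmulr_rlt0// subr_lt0.
  have lE : l * s = (1 - l) * rho * s by congr (_ * _); rewrite l1E mulrC.
  lra.
have e0 : 0 < 2^-1 * expR (- D) by rewrite mulr_gt0 ?expR_gt0.
have hA : ((fine (mu A))%:E <= mu A)%E by rewrite (fineK fA).
have := sublevel_log_concave gmu mF cF hM l01 cM p0 hA e0 hD.
rewrite lnM ?posrE ?expR_gt0// expRK lnV ?posrE// => h.
rewrite -[leLHS]lnK ?posrE// -[2^-1]lnK ?posrE// -expRD ler_expR lnV ?posrE//.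
have lE : l = (1 - l) * rho by rewrite l1E mulrC.
have hh : (1 - l) * (ln (fine (mu A)) + ln 2 - rho * D) <= 0.
  have h3 : l * ln 2 = (1 - l) * rho * ln 2 by rewrite -lE.
  have h4 : l * D = (1 - l) * rho * D by rewrite -lE.
  nra.
rewrite pmulr_rle0// in hh; lra.
Qed.

(** The gain inequality is applied to [h], a multiple of [(F - M + e * s)_+]
    truncated at [w] and equal to [w] where [M <= F].  The mean of [f] is at
    most a multiple of [E], and [k] vanishes where [F <= M - s]. *)
Lemma excess_lower_bound_gain (R : realType) n
    (mu : probability (n.-tuple (measurableTypeR R)) R)
    (F : n.-tuple (measurableTypeR R) -> R) (M s E e w L : R) :
  gauss_law mu -> measurable_fun setT F -> convexT F ->
  ((2^-1)%:E <= mu [set x | (M <= F x)%R])%E ->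
  (\int[mu]_x (Num.max (F x - M) 0)%:E = E%:E)%E ->
  0 < s -> ((expR (- L))%:E <= mu [set x | (F x <= M - s)%R])%E ->
  0 < e < 1 -> 0 < w ->
  - ln (2^-1 + 2^-1 * expR (- w)) <= (1 - e) * w / (e * s) * E + e ^+ 2 * L.
Proof.
move=> gmu mF cF hM hE s0 hL e01 w0; have /andP[e0 e1] := e01.
have es0 : 0 < e * s by rewrite mulr_gt0.
(* [c'] makes [h] reach [w] on [M <= F]; [c] and [N] are then forced by
   convexity, [N] being taken so that the weight of [k] is [e ^+ 2] *)
pose c' := w / (e * s); have c'0 : 0 < c' by rewrite divr_gt0.
pose c := (1 - e) * c'; have c0 : 0 <= c by rewrite mulr_ge0 ?subr_ge0 ?ltW.
pose N := c' / e; have N0 : 0 <= N by rewrite divr_ge0 ?ltW.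
pose f x := Num.min (excess c M (F x)) w.
pose h x := Num.min (excess c' (M - e * s) (F x)) w.
pose k x := excess N (M - s) (F x).
have mk : measurable_fun setT k by exact: measurable_excess.
have k0 x : 0 <= k x by exact: excess_ge0.
have mf : measurable_fun setT f.
  by apply: measurable_minr => //; exact: measurable_excess.
have f0 x : 0 <= f x by rewrite le_min excess_ge0//= ltW.
have mh : measurable_fun setT h.
  by apply: measurable_minr => //; exact: measurable_excess.
have h0 x : 0 <= h x by rewrite le_min excess_ge0//= ltW.
have gain : free_energy mu h <=
    fine (\int[mu]_x (f x)%:E) + e ^+ 2 * free_energy mu k.
  apply: (gaussian_gain (B := w)) => //.
  - by move=> x; rewrite f0/= ge_min lexx orbT.
  - exact: convexT_excess.
  - move=> x y.
    have e01' : 0 <= e <= 1 by lra.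
    have := excess_mix M (M - s) (F x) (F y) e01' (ltW c'0).
    rewrite (_ : (1 - e) * M + e * (M - s) = M - e * s); last ring.
    have := excess_homo (M - e * s) (ltW c'0) (cF e x y e01).
    have E1 : (1 - e) * excess c' M (F x) = excess c M (F x).
      by rewrite /excess /c mulrA.
    have E2 : e * excess c' (M - s) (F y) = e ^+ 2 * k y.
      by rewrite /k /excess /N; field; rewrite gt_eqF.
    rewrite E1 E2 => h1 h2; have h3 := le_trans h1 h2.
    have k0' : 0 <= e ^+ 2 * k y by rewrite mulr_ge0 ?sqr_ge0.
    rewrite /h /f addr_minl le_min !ge_min.
    apply/andP; split; apply/orP; first by left.
    by right; rewrite lerDl.
have hle : - ln (2^-1 + 2^-1 * expR (- w)) <= free_energy mu h.
  rewrite lerN2 ler_ln ?posrE; last 2 first.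
  - exact: laplace_gt0.
  - by rewrite addr_gt0// mulr_gt0 ?expR_gt0.
  apply: (laplace_le_half _ _ _ hM) => //.
  - exact: measurable_superlevel.
  - exact: ltW.
  - move=> x /= MF; rewrite le_min lexx andbT.
    have -> : w = c' * (e * s) by rewrite /c' divfK// gt_eqF.
    by rewrite /excess ler_wpM2l ?(ltW c'0)// le_max opprB addrCA lerDl subr_ge0 MF.
have kle : free_energy mu k <= L.
  rewrite -lerN2 opprK -ler_expR -lee_fin lnK ?posrE ?laplace_gt0//.
  apply: le_trans hL _; apply: laplace_ge_measure => //.
  - exact: measurable_sublevel.
  - by move=> x /= Fx; exact: excess_eq0.
have fle : fine (\int[mu]_x (f x)%:E) <= c * E.
  have mx0 x : 0 <= Num.max (F x - M) 0 by rewrite le_max lexx orbT.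
  have h1 : (\int[mu]_x (f x)%:E <= (c * E)%:E)%E.
    rewrite EFinM -hE -ge0_integralZl ?lee_fin//; last 2 first.
    - by apply/measurable_EFinP; apply: measurable_maxr => //; exact: measurable_funB.
    - by move=> x _; rewrite lee_fin.
    apply: ge0_le_integral => //.
    - by move=> x _; rewrite lee_fin.
    - exact/measurable_EFinP.
    - apply: measurable_funeM; apply/measurable_EFinP.
      by apply: measurable_maxr => //; exact: measurable_funB.
    - by move=> x _; rewrite -EFinM lee_fin ge_min lexx.
  have h2 : (0 <= \int[mu]_x (f x)%:E)%E.
    by apply: integral_ge0 => x _; rewrite lee_fin.
  rewrite -lee_fin fineK// ge0_fin_numE// (le_lt_trans h1) ?ltry//.
apply: le_trans hle _; apply: le_trans gain _; apply: lerD.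
  apply: le_trans fle _; rewrite /c /c' le_eqVlt; apply/orP; left; apply/eqP.
  by rewrite mulrA.
by rewrite ler_wpM2l ?sqr_ge0.
Qed.

(** * A lower bound for the Gaussian distribution function *)

Lemma dcdf_gdensN (R : realType) (r : R) :
  (dcdf (@gdens R) (- r))%:E =
  (\int[lebesgue_measure]_(x in `[r, +oo[) (gdens x)%:E)%E.
Proof.
rewrite dcdfE; last exact: prob_density_gdens.
rewrite ge0_integration_by_substitutionNy.
- by apply: eq_integral => x _; rewrite /= gdensN.
- by apply: continuous_subspaceT; exact: continuous_gdens.
- by move=> x _; rewrite ltW ?gdens_gt0.
Qed.

Lemma integral_gdens_half (R : realType) :
  (\int[lebesgue_measure]_(x in `[0%R, +oo[) (@gdens R x)%:E = (2^-1)%:E)%E.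
Proof.
have pg := prob_density_gdens R.
rewrite -dcdf_gdensN oppr0; congr _%:E.
have E1 := dcdf_gdensN (0 : R); rewrite oppr0 in E1.
have E2 := dcdf_compl (0 : R) pg.
have mg := @measurable_gdens R.
move: E2; rewrite integral_itv_obnd_cbnd; last first.
  by apply/measurable_EFinP; apply: measurable_funTS.
by rewrite -E1 => -[]; lra.
Qed.

Lemma gdens_cvgy (R : realType) : @gdens R x @[x --> +oo] --> 0.
Proof.
have c0 : 0 < (Num.sqrt (2 * pi))^-1 :> R by rewrite invr_gt0 sqrt2pi_gt0.
pose C : R := (Num.sqrt (2 * pi))^-1.
apply: (@squeeze_cvgr _ _ _ _ (cst 0) (fun x => C * expR 1 * expR (- x))).
- near=> x; rewrite /= ltW ?gdens_gt0//=.
  rewrite /gdens -mulrA ler_pM2l// -expRD ler_expR; nra.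
- exact: cvg_cst.
- rewrite -[X in _ --> X](mulr0 (C * expR 1)).
  by apply: cvgM; [exact: cvg_cst|exact: cvgr_expR].
Unshelve. all: by end_near. Qed.

Lemma integral_gdens_mean (R : realType) :
  (\int[lebesgue_measure]_(x in `[0%R, +oo[) (x * @gdens R x)%:E =
   (Num.sqrt (2 * pi))^-1%:E)%E.
Proof.
have dF (x : R) : is_derive x 1 (fun z => - gdens z) (x * gdens x).
  have dg := is_derive_gdens x.
  by apply: is_derive_eq; rewrite mulNr opprK.
have cF : continuous (fun z : R => - gdens z).
  by move=> x; exact: is_derive1_continuous (dF x).
have F0 : - gdens 0 = - (Num.sqrt (2 * pi))^-1 :> R.
  by rewrite /gdens expr0n/= oppr0 mul0r expR0 mulr1.
rewrite (@ge0_continuous_FTC2y _ _ (fun z => - gdens z) _ 0).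
- by rewrite F0 sub0e EFinN oppeK.
- by move=> x x0; rewrite mulr_ge0// ltW ?gdens_gt0.
- apply: continuous_subspaceT => x; apply: cvgM; first exact: cvg_id.
  exact: continuous_gdens.
- by rewrite -oppr0; apply: cvgN; exact: gdens_cvgy.
- by move=> x _; have [] := dF x.
- exact/cvg_at_right_filter/cF.
- by move=> x _; rewrite derive1E; have [_ ->] := dF x.
Qed.

(** Symmetry and a translation turn the left tail into the integral over the
    positive half-line of [gdens z * expR (- r * z - r ^+ 2 / 2)].  The Gaussian law
    gives this half-line mass [1 / 2] and its conditional mean there is
    [2 / sqrt (2 pi)], so Jensen's inequality gives the exponent. *)
Lemma dcdf_gdens_lower (R : realType) (r : R) : 0 <= r ->
  2^-1 * expR (- (2 * r / Num.sqrt (2 * pi) + r ^+ 2 / 2)) <=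
  dcdf (@gdens R) (- r).
Proof.
move=> r0; set sg := Num.sqrt (2 * pi).
have sg0 : 0 < sg by exact: sqrt2pi_gt0.
pose D := 2 * r / sg + r ^+ 2 / 2.
have mg := @measurable_gdens R.
have g0 (z : R) : 0 <= gdens z by rewrite ltW ?gdens_gt0.
have mI : measurable (`[0%R, +oo[%classic : set (measurableTypeR R)) by [].
rewrite -lee_fin dcdf_gdensN (@ge0_integral_translate _ r)//.
have -> : (fun z : R => z + r) @^-1` `[r, +oo[ = `[0, +oo[%classic.
  by apply/seteqP; split=> z /=; rewrite !in_itv/= !andbT; lra.
(* [- D] is the mean of the exponent [- r * z - r ^+ 2 / 2] under the half-normal
   law: Jensen's inequality is the tangent line of [expR] at this point *)
pose K := expR (- D).
have low : (\int[lebesgue_measure]_(z in `[0%R, +oo[)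
    (K * (1 + 2 * r / sg) * gdens z)%:E <=
    \int[lebesgue_measure]_(z in `[0%R, +oo[)
    (gdens (z + r))%:E + \int[lebesgue_measure]_(z in `[0%R, +oo[)
    (K * r * (z * gdens z))%:E)%E.
  have K0 : 0 <= K by exact: expR_ge0.
  have m1 : measurable_fun setT (fun z : R => gdens (z + r)).
    by apply: measurableT_comp => //; exact: measurable_funD.
  have m2 : measurable_fun setT (fun z : R => K * r * (z * gdens z)).
    by apply: measurable_funM => //; exact: measurable_funM.
  rewrite -ge0_integralD//=; last 4 first.
  - by move=> x _; rewrite lee_fin.
  - exact/measurable_EFinP/measurable_funTS.
  - move=> x; rewrite in_itv/= andbT => x0.
    by rewrite lee_fin !mulr_ge0.
  - exact/measurable_EFinP/measurable_funTS.
  apply: ge0_le_integral => //=.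
  - by move=> x _; rewrite lee_fin !mulr_ge0// addr_ge0// divr_ge0 ?mulr_ge0// ltW.
  - by apply/measurable_EFinP; apply: measurable_funTS; apply: measurable_funM.
  - apply: emeasurable_funD; exact/measurable_EFinP/measurable_funTS.
  - move=> x; rewrite in_itv/= andbT => x0; rewrite -EFinD lee_fin.
    have -> : gdens (x + r) = expR (- (r * x) - r ^+ 2 / 2) * gdens x.
      by rewrite /gdens mulrCA -expRD; congr (_ * expR _); field.
    have := expR_ge_tangent (- (r * x) - r ^+ 2 / 2) (- D).
    rewrite -/K /D; set T := expR _ => h.
    rewrite -subr_ge0.
    have -> : T * gdens x + K * r * (x * gdens x) - K * (1 + 2 * r / sg) * gdens x
      = gdens x * (T - K * (1 + 2 * r / sg - r * x)) by ring.
    rewrite mulr_ge0// subr_ge0; apply: le_trans h.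
    by rewrite le_eqVlt; apply/orP; left; apply/eqP; congr (_ * _); ring.
move: low; under eq_integral do rewrite EFinM.
rewrite ge0_integralZl ?lee_fin//; last 3 first.
- exact/measurable_EFinP/measurable_funTS.
- by move=> x _; rewrite lee_fin.
- by rewrite mulr_ge0 ?expR_ge0// addr_ge0// divr_ge0 ?mulr_ge0// ltW.
rewrite integral_gdens_half.
under [X in (_ <= _ + X)%E -> _]eq_integral do rewrite EFinM.
rewrite ge0_integralZl ?lee_fin ?mulr_ge0 ?expR_ge0//; last 2 first.
- by apply/measurable_EFinP; apply: measurable_funTS; exact: measurable_funM.
- move=> x /=; rewrite in_itv/= andbT => x0.
  by rewrite lee_fin mulr_ge0.
rewrite integral_gdens_mean -!EFinM -leeBlDr// -EFinB; apply: le_trans.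
rewrite lee_fin le_eqVlt; apply/orP; left; apply/eqP; rewrite -/sg -/D -/K.
by field; rewrite gt_eqF.
Qed.

Lemma PhiE (R : realType) (x : R) : Phi x = dcdf (@gdens R) x.
Proof.
have s0 : Num.sqrt (2 * pi) != 0 :> R by rewrite gt_eqF ?sqrt2pi_gt0.
rewrite /Phi /dcdf.
transitivity ((Num.sqrt (2 * pi))^-1 * \int[lebesgue_measure]_(z in `]-oo, x])
    (Num.sqrt (2 * pi) * gdens z)).
  congr (_ * _); apply: eq_Rintegral => z _.
  by rewrite /gdens mulrA divff ?mul1r.
rewrite RintegralZl//; first by rewrite mulrA mulVf ?mul1r.
exact: integrable_prob_density (prob_density_gdens R).
Qed.

(** * Numerical estimates *)

(** The number [tan (pi / 8)] is the positive root of [y ^+ 2 + 2 * y = 1], and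
    [x <= tan x]. *)
Lemma pi_le_10div3 (R : realType) : pi <= 10 / 3 :> R.
Proof.
have p2 := @pi_ge2 R; set x : R := pi / 8.
have x0 : 0 < x by rewrite /x; lra.
have cp (z : R) : 0 <= z <= x -> 0 < cos z.
  by move=> zx; apply: cos_gt0_pihalf; move: zx; rewrite /x; lra.
have cx : cos x != 0 by rewrite gt_eqF// cp// lexx andbT ltW.
have tx : x <= tan x.
  have dt (z : R) : z \in `]0, x[ -> is_derive z 1 tan ((cos z)^-2).
    rewrite in_itv/= => /andP[z0 zx]; apply: is_derive_tan.
    by rewrite gt_eqF// cp// !ltW.
  have ct : {within `[0, x], continuous (@tan R)}.
    apply: continuous_in_subspaceT => z; rewrite inE/= in_itv/= => zx.
    by apply: continuous_tan; rewrite gt_eqF// cp.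
  have [z] := MVT x0 dt ct.
  rewrite in_itv/= => /andP[z0 zx].
  rewrite tan0 !subr0 => ->; rewrite ler_peMl ?(ltW x0)//.
  have cz : 0 < cos z by rewrite cp// !ltW.
  rewrite invf_ge1 ?exprn_gt0// exprn_ile1 ?cos_le1//; exact: ltW.
have t1 : tan x ^+ 2 + 2 * tan x = 1.
  have := tan_mulr2n cx; rewrite (_ : x *+ 2 = pi / 4); last first.
    by rewrite /x -mulr_natl; field.
  rewrite tan_piquarter => E.
  have N0 : 1 - tan x ^+ 2 != 0.
    by apply/eqP => N; move: E; rewrite N invr0 mulr0 => /eqP; rewrite oner_eq0.
  have : 1 - tan x ^+ 2 = tan x *+ 2.
    by apply: (divIf N0); rewrite divff.
  lra.
suff : tan x <= 10 / 24 by rewrite /x in tx *; lra.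
nra.
Qed.

Lemma sqrt2pi_bounds (R : realType) :
  2 <= Num.sqrt (2 * pi : R) <= 26 / 10.
Proof.
have p2 := @pi_ge2 R; have p3 := @pi_le_10div3 R.
have := @sqr_sqrtr R (2 * pi).
have := @sqrtr_ge0 R (2 * pi).
move: (Num.sqrt _) => s s0 /(_ _) sE.
have {}sE : s ^+ 2 = 2 * pi by apply: sE; lra.
by apply/andP; split; nra.
Qed.

(** Used with rational arguments, this gives rational bounds for exponentials. *)
Lemma expR_ge_pow (R : realType) (n : nat) (x : R) : - n.+1%:R <= x ->
  (1 + x / n.+1%:R) ^+ n.+1 <= expR x.
Proof.
move=> nx; have n0 : 0 < n.+1%:R :> R by rewrite ltr0n.
rewrite [in leRHS](_ : x = n.+1%:R * (x / n.+1%:R)); last first.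
  by rewrite mulrC divfK// gt_eqF.
rewrite expRM_natl lerXn2r ?nnegrE ?expR_ge0 ?expR_ge1Dx//.
by rewrite -lerBlDl sub0r ler_pdivlMr// mulN1r.
Qed.

Lemma expR_37_le (R : realType) : expR (37 / 100) <= 1455 / 1000 :> R.
Proof.
have h := @expR_ge_pow R 15 (- (37 / 100)); rewrite expRN in h.
have {}h : (1 + - (37 / 100) / 16%:R) ^+ 16 <= (expR (37 / 100))^-1 :> R.
  by apply: h; lra.
have p0 := expR_gt0 (37 / 100 : R).
have {}h : 6877 / 10000 <= (expR (37 / 100))^-1 :> R by apply: le_trans h; lra.
by rewrite -[(expR _)^-1]mul1r ler_pdivlMr// in h; lra.
Qed.

(** A lower bound for the left-hand side of excess_lower_bound_gain at [w = 1]. *)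
Lemma log_gain_ge (R : realType) :
  375 / 1000 <= - ln (2^-1 + 2^-1 * expR (- 1)) :> R.
Proof.
have h1 : (1 + 1 / 64%:R) ^+ 64 <= expR 1 :> R by apply: expR_ge_pow; lra.
have {}h1 : 2697 / 1000 <= expR 1 :> R by apply: le_trans h1; lra.
have h2 : (1 + - (375 / 1000) / 32%:R) ^+ 32 <= expR (- (375 / 1000)) :> R.
  by apply: expR_ge_pow; lra.
have {}h2 : 1371 / 2000 <= expR (- (375 / 1000)) :> R by apply: le_trans h2; lra.
have p0 := expR_gt0 (- 1 : R).
rewrite lerNr -ler_expR lnK ?posrE; last lra.
suff : expR (- 1) <= 927 / 2500 :> R by lra.
by rewrite expRN -[(expR _)^-1]mul1r ler_pdivrMr ?expR_gt0//; lra.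
Qed.

Lemma ln2_le (R : realType) : ln 2 <= 7 / 10 :> R.
Proof.
have h : (1 + 7 / 10 / 64%:R) ^+ 64 <= expR (7 / 10) :> R.
  by apply: expR_ge_pow; lra.
rewrite -ler_expR lnK ?posrE//; apply: le_trans h; lra.
Qed.


(** The hypothesis is excess_lower_bound_log_concave with [rho = 37 / 100 / D] and
    [u] just below [rho * s]; the value [37 / 100] nearly maximizes
    [x * (1 - expR x / 2)]. *)
Lemma small_quantile_arith (R : realType) (sg r s D E e : R) :
  0 < sg -> 0 < r -> 0 < s -> 0 < D ->
  sg * D = 2 * r + sg * r ^+ 2 / 2 -> sg * r <= 47 / 20 ->
  e <= 1455 / 1000 ->
  999 / 1000 * (37 / 100 / D * s) * (1 - 2^-1 * e) <= E ->
  sg * s <= 32 * r * E.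
Proof.
move=> sg0 r0 s0 D0 sD small e37 h.
have h1 : s / D <= 10 * E.
  rewrite -ler_pdivrMl//; apply: le_trans h.
  have sD0 : 0 < s / D by rewrite divr_gt0.
  rewrite (_ : 37 / 100 / D * s = 37 / 100 * (s / D)); last by rewrite mulrAC -mulrA.
  move: (s / D) sD0 => q q0.
  have : q * e <= q * (1455 / 1000) by rewrite ler_wpM2l// ltW.
  lra.
have h2 : s <= 10 * E * D by rewrite -ler_pdivrMr.
have h3 : sg * D <= 32 / 10 * r.
  have : r * (sg * r) <= r * (47 / 20) by rewrite ler_wpM2l// ltW.
  rewrite sD; lra.
have E0 : 0 <= E.
  by rewrite -(@pmulr_rge0 _ 10)//; apply: le_trans h1; rewrite divr_ge0// ltW.
have h4 : E * (sg * D) <= E * (32 / 10 * r) by rewrite ler_wpM2l.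
have h5 : sg * s <= sg * (10 * E * D) by rewrite ler_wpM2l// ltW.
lra.
Qed.

(** The hypothesis is excess_lower_bound_gain with [w = 1] and [D] increased by
    [ln 2].  Arguing by contradiction, [E] is eliminated and, in terms of [sg] and
    of [z = 47 / 20 / (sg * r)], which lies between 0 and 1, the right-hand side is
    largest at [z = 1], [sg = 26 / 10], where it is still below the left-hand
    side. *)
Lemma large_quantile_arith (R : realType) (sg r s D E l : R) :
  2 <= sg -> sg <= 26 / 10 -> 0 < s -> l <= 7 / 10 ->
  D = 2 * r / sg + r ^+ 2 / 2 -> 9 / 10 < r -> 47 / 20 < sg * r ->
  let e := (4 * r)^-1 in
  375 / 1000 <= (1 - e) * 1 / (e * s) * E + e ^+ 2 * (l + D) ->
  sg * s <= 32 * r * E.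
Proof.
move=> sg2 sg26 s0 l7 DE r1 large e gain; rewrite leNgt; apply/negP => contra.
have sg0 : 0 < sg by lra.
have r0 : 0 < r by lra.
have y0 : 0 < r^-1 by rewrite invr_gt0.
have sr0 : 0 < sg * r by rewrite mulr_gt0.
(* [z] replaces [r]; it makes the terms in [r^-1 / sg] linear *)
pose z := 47 / 20 / (sg * r).
have z0 : 0 < z by rewrite divr_gt0.
have z1 : z < 1 by rewrite /z ltr_pdivrMr// mul1r.
have yz : r^-1 = 20 / 47 * sg * z by rewrite /z; field; rewrite !gt_eqF.
have t1 : (1 - e) * 1 / (e * s) * E <= sg / 8 - sg * r^-1 / 32.
  have -> : (1 - e) * 1 / (e * s) * E = (4 * r - 1) * (E / s).
    by rewrite /e; field; rewrite !gt_eqF.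
  have E1 : E / s <= sg / 32 * r^-1.
    rewrite ler_pdivrMr// mulrAC ler_pdivlMr//.
    by move: contra; clear; lra.
  have h : (4 * r - 1) * (E / s) <= (4 * r - 1) * (sg / 32 * r^-1).
    by apply: ler_wpM2l => //; lra.
  apply: le_trans h _; rewrite le_eqVlt; apply/orP; left; apply/eqP.
  by field; rewrite gt_eqF.
have t2 : e ^+ 2 * (l + D) <= 7 / 160 * r^-1 ^+ 2 + 20 / 47 * z / 8 + 1 / 32.
  have -> : e ^+ 2 * (l + D) = l * r^-1 ^+ 2 / 16 + 20 / 47 * z / 8 + 1 / 32.
    by rewrite /e DE /z; field; rewrite !gt_eqF.
  have : l * r^-1 ^+ 2 <= 7 / 10 * r^-1 ^+ 2 by rewrite ler_wpM2r// sqr_ge0.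
  by clear; lra.
have zz : z ^+ 2 <= z by rewrite expr2 ler_piMl// ltW.
have ss : sg ^+ 2 * z ^+ 2 <= sg ^+ 2 * z by rewrite ler_wpM2l// sqr_ge0.
have {gain t1 t2} := le_trans gain (lerD t1 t2).
rewrite yz; move: sg2 sg26 z0 z1 ss; clear.
move=> sg2 sg26 z0 z1 ss gain.
have s1 : 0 <= (26 / 10 - sg) ^+ 2 * z by rewrite mulr_ge0 ?sqr_ge0// ltW.
have s2 : 0 <= (26 / 10 - sg) * (1 - z) by rewrite mulr_ge0 ?subr_ge0 ?(ltW z1).
move: {z}(z : R) z0 z1 ss s1 s2 gain => z; lra.
Qed.

(** * The mean excess against the gap between quantiles *)

(** The log-concavity of sublevel sets is precise enough while [sg * r] is at most
    [47 / 20], and the gain with [e = 1 / (4 r)] beyond; the two ranges in which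
    the estimates succeed overlap around this threshold. *)
Lemma excess_ge_quantile_gap (R : realType) n
    (mu : probability (n.-tuple (measurableTypeR R)) R)
    (F : n.-tuple (measurableTypeR R) -> R) (M s E r : R) :
  gauss_law mu -> measurable_fun setT F -> convexT F ->
  ((2^-1)%:E <= mu [set x | (M <= F x)%R])%E ->
  (\int[mu]_x (Num.max (F x - M) 0)%:E = E%:E)%E ->
  0 < s -> 0 < r ->
  ((dcdf (@gdens R) (- r))%:E <= mu [set x | (F x <= M - s)%R])%E ->
  Num.sqrt (2 * pi) * s <= 32 * r * E.
Proof.
move=> gmu mF cF hM hE s0 r0 hL.
have /andP[sg2 sg26] := sqrt2pi_bounds R.
have := dcdf_gdens_lower (ltW r0).
move: (Num.sqrt _) sg2 sg26 => sg sg2 sg26 low.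
have sg0 : 0 < sg by lra.
set D := 2 * r / sg + r ^+ 2 / 2 in low.
have D0 : 0 < D by rewrite addr_gt0 ?divr_gt0 ?mulr_gt0 ?exprn_gt0.
have {hL}hD : ((2^-1 * expR (- D))%:E <= mu [set x | (F x <= M - s)%R])%E.
  by apply: le_trans hL; rewrite lee_fin.
have sD : sg * D = 2 * r + sg * r ^+ 2 / 2 by rewrite /D; field; rewrite gt_eqF.
have [small|large] := lerP (sg * r) (47 / 20).
  pose rho := 37 / 100 / D.
  have rho0 : 0 < rho by rewrite divr_gt0.
  (* [u < rho * s] has to be strict *)
  pose u := 999 / 1000 * (rho * s).
  have rs0 : 0 < rho * s by rewrite mulr_gt0.
  have u0 : 0 < u by rewrite mulr_gt0 ?divr_gt0 ?ltr0n.
  have us : u < rho * s.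
    by rewrite /u; move: (rho * s) rs0; clear; move=> q q0; lra.
  have := excess_lower_bound_log_concave gmu mF cF hM hE s0 hD u0 rho0 us.
  have -> : rho * D = 37 / 100 by rewrite /rho divfK// gt_eqF.
  exact: (small_quantile_arith sg0 r0 s0 D0 sD small (expR_37_le R)).
pose e := (4 * r)^-1.
have r1 : 9 / 10 < r.
  have sgr : sg * r <= 26 / 10 * r by rewrite ler_wpM2r// ltW.
  by move: large sgr; clear; lra.
have e01 : 0 < e < 1.
  rewrite invr_gt0 mulr_gt0//= invf_lt1 ?mulr_gt0//.
  by move: r1; clear; lra.
have hL : ((expR (- (ln 2 + D)))%:E <= mu [set x | (F x <= M - s)%R])%E.
  by rewrite opprD expRD expRN lnK ?posrE.
have := excess_lower_bound_gain gmu mF cF hM hE s0 hL e01 ltr01.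
move/(le_trans (log_gain_ge R)).
exact: (large_quantile_arith sg2 sg26 s0 (ln2_le R) erefl r1 large).
Qed.

(** * Gaussian row vectors as tuples *)

Definition coord_tuple (R : realType) n (v : 'rV[R]_n) :
  n.-tuple (measurableTypeR R) := [tuple (v ord0 i : R) | i < n].

Definition row_of_tuple (R : realType) n (s : n.-tuple (measurableTypeR R)) :
  'rV[R]_n := \row_i tnth s i.

Lemma coord_tupleK (R : realType) n :
  cancel (@coord_tuple R n) (@row_of_tuple R n).
Proof. by move=> v; apply/rowP => i; rewrite mxE tnth_mktuple. Qed.

Lemma measurable_coord_tuple (R : realType) n :
  measurable_fun setT (@coord_tuple R n).
Proof.
apply/measurable_fun_tnthP => i.
rewrite (_ : _ \o _ = fun v : 'rV[R]_n => v ord0 i); last first.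
  by apply/funext => v /=; rewrite tnth_mktuple.
apply: (measurability _ (RGenOpens.measurableE R)) => _ [_ [a [b ->] <-]].
rewrite setTI; apply: sub_sigma_algebra.
by have /continuousP := @coord_continuous R 1 n ord0 i; apply; exact: interval_open.
Qed.

(** The Borel sets of row vectors are generated by the open sets, and an open set
    is a countable union of cubes with rational centres, whose preimages are
    boxes. *)
Lemma measurable_row_of_tuple (R : realType) n :
  measurable_fun setT (@row_of_tuple R n).
Proof.
apply: (@measurability _ _ _ _ _ _ (@open 'rV[R]_n)) => // _ [U oU <-].
rewrite setTI.
pose B (p : {ffun 'I_n -> rat} * nat) : set (n.-tuple (measurableTypeR R)) :=
  box (fun i => ball (ratr (p.1 i) : R) (p.2.+1%:R^-1)).
(* the cubes [B p] that lie in the preimage of [U] *)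
pose C p := if `[< B p `<=` @row_of_tuple R n @^-1` U >] then B p else set0.
have mB p : measurable (B p).
  apply: measurable_box => i; apply: open_measurable; exact: ball_open.
have -> : @row_of_tuple R n @^-1` U = \bigcup_p C p.
  apply/seteqP; split => [s /= sU|s [p _]]; last first.
    by rewrite /C; case: asboolP => // BU /BU.
  have := open_nbhs_nbhs (conj oU sU); move/nbhs_ballP => [e /= e0 eU].
  have [N Ne] : exists N : nat, 2 * N.+1%:R^-1 < e.
    exists (Num.truncn (2 / e)); rewrite ltr_pdivrMr// mulrC -ltr_pdivrMr//.
    exact: truncnS_gt.
  have N0 : 0 < N.+1%:R^-1 :> R by rewrite invr_gt0 ltr0n.
  have q_ i : exists q : rat, `|ratr q - tnth s i| < N.+1%:R^-1.
    move: (tnth s i : R) (N.+1%:R^-1 : R) N0 => z a a0.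
    have : z - a < z + a by lra.
    move=> /rat_in_itvoo[q]; rewrite in_itv/= => qs; exists q.
    by rewrite ltr_norml; lra.
  have [q qs] := choice q_.
  have Bs : B ([ffun i => q i], N) s.
    by move=> i /=; rewrite ffunE; exact: qs.
  exists ([ffun i => q i], N) => //; rewrite /C asboolT// => t Bt.
  apply: eU; split => // i j; rewrite !mxE /ball/=.
  have := Bt j; have := qs j; rewrite /ball/= ffunE.
  move: (tnth s j : R) (tnth t j : R) (N.+1%:R^-1 : R) Ne => z z' a Ne.
  rewrite !ltr_norml; lra.
apply: countable_bigcupT_measurable => // p.
by rewrite /C; case: asboolP.
Qed.

HB.instance Definition _ (R : realType) n :=
  isMeasurableFun.Build _ _ _ _ (@coord_tuple R n) (@measurable_coord_tuple R n).

Definition tuple_law d (Omega : measurableType d) (R : realType)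
    (P : probability Omega R) n (Z : {RV P >-> 'rV[R]_n}) :
    probability (n.-tuple (measurableTypeR R)) R :=
  distribution P (@coord_tuple R n \o Z).

Lemma gauss_law_std_gaussian d (Omega : measurableType d) (R : realType)
    (P : probability Omega R) n (Z : {RV P >-> 'rV[R]_n}) :
  std_gaussian_vector Z -> gauss_law (tuple_law Z).
Proof.
move=> [Z1 Zi] A mA; rewrite /tuple_law /distribution/= /pushforward.
transitivity (P [set w | forall i, A i (Z w ord0 i)]).
  congr (P _); apply/seteqP; split=> w /= h i; have := h i.
    by rewrite tnth_mktuple.
  by rewrite tnth_mktuple.
rewrite (Zi A mA); apply: eq_bigr => i _.
exact (Z1 i (A i) (mA i)).
Qed.

Lemma convexT_row_of_tuple (R : realType) n (f : 'rV[R]_n -> R) :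
  @convex_function R 'rV[R]_n setT f -> convexT (f \o @row_of_tuple R n).
Proof.
move=> cf l x y /andP[l0 l1] /=.
have l'0 : 0 <= 1 - l by rewrite subr_ge0 ltW.
have l'1 : 1 - l <= 1 by rewrite gerBl ltW.
have -> : row_of_tuple (tmix l x y) =
    (1 - l) *: row_of_tuple x + (1 - (1 - l)) *: row_of_tuple y.
  by apply/rowP => i; rewrite !mxE tnth_mktuple subKr.
rewrite -[X in _ + X * _](subKr 1 l).
exact: (cf (Itv01 l'0 l'1) _ _ (in_setT _) (in_setT _)).
Qed.
Theorem theorem2p1 (R : realType) (d : measure_display)
    (Omega : measurableType d) (P : probability Omega R) (n : nat)
    (Z : {RV P >-> 'rV[R]_n}) (hZ : std_gaussian_vector Z)
    (f : 'rV[R]_n -> R)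
    (hconvex : @convex_function R 'rV[R]_n setT f)
    (hL1 : (distribution P Z).-integrable setT (EFin \o f))
    (M : R) (hM : median P (f \o Z) M) (t : R) (ht : 0 < t) :
  (P [set w | ((f (Z w) - M)%:E <
               - (t%:E * 'E_P[fun w' => (Num.max (f (Z w') - M) 0)%R]))%E]
   <= (Phi (- (Num.sqrt (2 * pi) / 32) * t))%:E)%E.
Proof.
set c := Num.sqrt (2 * pi) / 32.
have c0 : 0 < c by rewrite divr_gt0 ?sqrt2pi_gt0.
have mf : measurable_fun setT f.
  by apply/measurable_EFinP; case/integrableP : hL1.
pose X := @coord_tuple R n \o Z.
pose mu := tuple_law Z; pose F := f \o @row_of_tuple R n.
have FX w : F (X w) = f (Z w) by rewrite /F /X /= coord_tupleK.
have gmu : gauss_law mu := gauss_law_std_gaussian hZ.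
have mF : measurable_fun setT F.
  exact: measurableT_comp mf (@measurable_row_of_tuple R n).
have cF : convexT F := convexT_row_of_tuple hconvex.
pose g v := Num.max (f v - M) 0.
have g0 v : 0 <= g v by rewrite /g le_max lexx orbT.
have mg : measurable_fun setT g.
  by apply: measurable_maxr => //; exact: measurable_funB.
have iP : ('E_P[fun w => Num.max (f (Z w) - M)%R 0%R] =
    \int[distribution P Z]_v (g v)%:E)%E.
  rewrite unlock /distribution ge0_integral_pushforward//.
  - exact/measurable_EFinP.
  - by move=> v _; rewrite lee_fin.
have iF : (\int[distribution P Z]_v (g v)%:E)%E \is a fin_num.
  apply: integrable_fin_num => //.
  have icst := finite_measure_integrable_cst (distribution P Z) M measurableT.
  have := integrable_funepos measurableT (integrableB measurableT hL1 icst).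
  apply: eq_integrable => // v _; rewrite funeposE /g EFin_max.
  by rewrite /= EFinB.
set E := fine (\int[distribution P Z]_v (g v)%:E)%E.
have E0 : 0 <= E.
  by apply: fine_ge0; apply: integral_ge0 => v _; rewrite lee_fin.
rewrite iP -(fineK iF) -/E.
have hE : (\int[mu]_x (Num.max (F x - M) 0)%:E = E%:E)%E.
  rewrite /E (fineK iF) /mu /tuple_law /distribution.
  rewrite !ge0_integral_pushforward//.
  - by apply: eq_integral => w _; rewrite /= /g -(FX w).
  - exact/measurable_EFinP.
  - by move=> v _; rewrite lee_fin.
  - apply/measurable_EFinP; apply: measurable_maxr => //.
    exact: measurable_funB.
  - by move=> v _; rewrite lee_fin le_max lexx orbT.
have hMF : ((2^-1)%:E <= mu [set x | (M <= F x)%R])%E.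
  case: hM => _; congr (_ <= P _)%E.
  by apply/seteqP; split => w /=; rewrite -(FX w).
pose s k : R := t * E + k.+1%:R^-1.
pose A k := [set w | f (Z w) <= M - s k].
have AE k : P (A k) = mu [set x | F x <= M - s k].
  congr (P _); by apply/seteqP; split => w /=; rewrite /A /= -(FX w).
have bound k : (P (A k) <= (Phi (- c * t))%:E)%E.
  rewrite leNgt; apply/negP => contra.
  have sk0 : 0 < s k.
    by rewrite ltr_wpDl ?invr_gt0 ?ltr0n// mulr_ge0// ltW.
  have := @excess_ge_quantile_gap R n mu F M (s k) E (c * t) gmu mF cF hMF hE sk0.
  rewrite mulr_gt0// -AE -PhiE -mulNr => /(_ isT (ltW contra)).
  rewrite /c /s; apply/negP; rewrite -ltNge.
  have k0 : 0 < k.+1%:R^-1 :> R by rewrite invr_gt0 ltr0n.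
  have sg0 := sqrt2pi_gt0 R.
  rewrite (_ : 32 * _ * E = Num.sqrt (2 * pi) * (t * E)); last by field.
  by rewrite ltr_pM2l// ltrDl.
have -> : [set w | ((f (Z w) - M)%:E < - (t%:E * E%:E))%E] = \bigcup_k A k.
  apply/seteqP; split => w /=; rewrite lte_fin /A.
    move=> fw; pose a := - (t * E) - (f (Z w) - M).
    have a0 : 0 < a by rewrite subr_gt0.
    exists (Num.truncn a^-1) => //=; rewrite /s.
    have : (Num.truncn a^-1).+1%:R^-1 <= a.
      by rewrite -[leRHS]invrK lef_pV2 ?posrE ?invr_gt0// ltW// truncnS_gt.
    move: (_.+1%:R^-1 : R) => q; rewrite /a; move: (f (Z w)) (t * E) => y z; lra.
  move=> [k _ /=]; rewrite /s.
  have : 0 < k.+1%:R^-1 :> R by rewrite invr_gt0 ltr0n.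
  move: (_.+1%:R^-1 : R) (f (Z w)) (t * E) => q y z; lra.
have mA k : measurable (A k).
  apply: (@measurable_sublevel _ _ _ (f \o Z) (M - s k)).
  exact: measurableT_comp.
have ndA : nondecreasing_seq A.
  move=> k m km; apply/subsetPset => w; rewrite /A /= => /le_trans; apply.
  rewrite lerD2l lerN2 lerD2l lef_pV2 ?posrE ?ltr0n//.
  by rewrite ler_nat.
have cA := @nondecreasing_cvg_mu _ _ _ P _ mA (bigcup_measurable (fun k _ => mA k)) ndA.
rewrite -(cvg_lim _ cA)//; apply: lime_le; first by apply/cvg_ex; eexists; exact: cA.
exact: nearW.
Qed.
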